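(* Let $I\rightarrowtail E\twoheadrightarrow Q$ be an extension of Fréchet spaces. If $Q$ is nuclear, then $I\rightarrowtail E\twoheadrightarrow Q$ is both pure ind-locally split and pure pro-locally split.
   Context: An extension of Fréchet spaces is a diagram $I\xrightarrow{i}E\xrightarrow{p}Q$ of continuous linear maps with $i$ a kernel of $p$ and $p$ a cokernel of $i$; equivalently (Open Mapping Theorem) it is a short exact sequence of vector spaces. $\otimes$ denotes the complete projective topological tensor product. An extension $I\to E\to Q$ of Fréchet spaces is ind-locally split if every compact linear map $V\to Q$ from a Banach space $V$ lifts to a continuous linear map $V\to E$. It is pro-locally split if every continuous linear map $I\to V$ to a Banach space $V$ extends to a continuous linear map $E\to V$. It is pure ind-locally split (respectively pure pro-locally split) if, for every Fréchet space $V$, the diagram $I\otimes V\to E\otimes V\to Q\otimes V$ is an ind-locally split (respectively pro-locally split) extension of Fréchet spaces. *)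

(* Defs.v *)
From HB Require Import structures.
From mathcomp Require Import all_boot all_order all_algebra.
From mathcomp Require Import sesquilinear.
From mathcomp Require Import all_classical all_reals all_analysis.
From mathcomp.real_closed Require Import complex.

Set Implicit Arguments.
Unset Strict Implicit.
Unset Printing Implicit Defensive.

Import Order.TTheory GRing.Theory Num.Theory.
Import numFieldNormedType.Exports.

Local Open Scope classical_set_scope.
Local Open Scope ring_scope.

Section FrechetSpaces.
Variable K : numFieldType.

(* [tvsType K] is the library's type of locally convex topological vector
   spaces.  It does not require its uniform structure to be the translation
   invariant one, so Cauchy filters and completeness are expressed with
   neighbourhoods of 0 instead of [cauchy]. *)
Definition tvs_cauchy (E : tvsType K) (F : set_system E) : Prop :=
  (fun xy : E * E => xy.1 - xy.2) @ (F, F) --> (0 : E).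

Definition tvs_complete (E : tvsType K) : Prop :=
  forall F : set_system E, ProperFilter F -> tvs_cauchy F ->
    exists x : E, F --> x.

Definition complete_hausdorff (E : tvsType K) : Prop :=
  hausdorff_space E /\ tvs_complete E.

(* A Hausdorff topological vector space is metrizable if and only if 0 has a
   countable neighbourhood basis. *)
Definition countable_basis0 (E : tvsType K) : Prop :=
  exists2 B : nat -> set E,
    (forall n, nbhs (0 : E) (B n)) &
    (forall U, nbhs (0 : E) U -> exists n, B n `<=` U).

Definition frechet_space (E : tvsType K) : Prop :=
  complete_hausdorff E /\ countable_basis0 E.

(* Kernels and cokernels in the category of Frechet spaces and continuous
   linear maps. *)
Definition frechet_kernel (I E Q : tvsType K)
    (i : {linear I -> E}) (p : {linear E -> Q}) : Prop :=
  (forall x, p (i x) = 0) /\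
  forall (W : tvsType K) (f : {linear W -> E}),
    frechet_space W -> continuous f -> (forall w, p (f w) = 0) ->
    exists g : {linear W -> I},
      [/\ continuous g, (forall w, i (g w) = f w) &
          forall h : {linear W -> I},
            continuous h -> (forall w, i (h w) = f w) -> h =1 g].

Definition frechet_cokernel (I E Q : tvsType K)
    (i : {linear I -> E}) (p : {linear E -> Q}) : Prop :=
  (forall x, p (i x) = 0) /\
  forall (W : tvsType K) (f : {linear E -> W}),
    frechet_space W -> continuous f -> (forall x, f (i x) = 0) ->
    exists g : {linear Q -> W},
      [/\ continuous g, (forall y, g (p y) = f y) &
          forall h : {linear Q -> W},
            continuous h -> (forall y, h (p y) = f y) -> h =1 g].

Definition frechet_extension (I E Q : tvsType K)
    (i : {linear I -> E}) (p : {linear E -> Q}) : Prop :=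
  [/\ frechet_space I, frechet_space E & frechet_space Q] /\
  [/\ continuous i, continuous p, frechet_kernel i p & frechet_cokernel i p].

Definition compact_linear_map (V : completeNormedModType K) (Q : tvsType K)
    (u : {linear V -> Q}) : Prop :=
  precompact (u @` ball (0 : V) 1).

Definition ind_locally_split (I E Q : tvsType K)
    (i : {linear I -> E}) (p : {linear E -> Q}) : Prop :=
  frechet_extension i p /\
  forall (V : completeNormedModType K) (u : {linear V -> Q}),
    compact_linear_map u ->
    exists2 l : {linear V -> E}, continuous l & forall v, p (l v) = u v.

Definition pro_locally_split (I E Q : tvsType K)
    (i : {linear I -> E}) (p : {linear E -> Q}) : Prop :=
  frechet_extension i p /\
  forall (V : completeNormedModType K) (u : {linear I -> V}),
    continuous u ->
    exists2 l : {linear E -> V}, continuous l & forall x, l (i x) = u x.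

Definition continuous_bilinear (E F T : tvsType K)
    (t : {bilinear E -> F -> T}) : Prop :=
  continuous (fun xy : E * F => t xy.1 xy.2).

(* [T], with the bilinear map [t], is a complete projective tensor product of
   [E] and [F]: it is the universal target, among complete Hausdorff locally
   convex spaces, for jointly continuous bilinear maps on [E * F]. *)
Definition complete_projective_tensor (E F T : tvsType K)
    (t : {bilinear E -> F -> T}) : Prop :=
  [/\ complete_hausdorff T, continuous_bilinear t &
      forall (W : tvsType K) (b : {bilinear E -> F -> W}),
        complete_hausdorff W -> continuous_bilinear b ->
        exists g : {linear T -> W},
          [/\ continuous g, (forall x y, g (t x y) = b x y) &
              forall h : {linear T -> W},
                continuous h -> (forall x y, h (t x y) = b x y) -> h =1 g]].

(* [f'] is the map [f (x) id_V] between complete projective tensor products. *)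
Definition tensor_id (E F V TE TF : tvsType K)
    (tE : {bilinear E -> V -> TE}) (tF : {bilinear F -> V -> TF})
    (f : {linear E -> F}) (f' : {linear TE -> TF}) : Prop :=
  continuous f' /\ forall x v, f' (tE x v) = tF (f x) v.

(* The complete projective tensor product is only determined up to unique
   isomorphism, so the condition is imposed on every model of
   [I (x) V -> E (x) V -> Q (x) V]. *)
Definition pure (P : forall I E Q : tvsType K,
      {linear I -> E} -> {linear E -> Q} -> Prop)
    (I E Q : tvsType K) (i : {linear I -> E}) (p : {linear E -> Q}) : Prop :=
  forall V : tvsType K, frechet_space V ->
  forall (IV EV QV : tvsType K)
    (tI : {bilinear I -> V -> IV}) (tE : {bilinear E -> V -> EV})
    (tQ : {bilinear Q -> V -> QV})
    (iV : {linear IV -> EV}) (pV : {linear EV -> QV}),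
    complete_projective_tensor tI -> complete_projective_tensor tE ->
    complete_projective_tensor tQ ->
    tensor_id tI tE i iV -> tensor_id tE tQ p pV ->
    P IV EV QV iV pV.

Definition pure_ind_locally_split (I E Q : tvsType K)
    (i : {linear I -> E}) (p : {linear E -> Q}) : Prop :=
  pure ind_locally_split i p.

Definition pure_pro_locally_split (I E Q : tvsType K)
    (i : {linear I -> E}) (p : {linear E -> Q}) : Prop :=
  pure pro_locally_split i p.

(* Nuclear map from a locally convex space to a Banach space:
   u x = \sum_n lam_n f_n(x) y_n with (lam_n) absolutely summable, (f_n) an
   equicontinuous sequence of linear functionals, (y_n) bounded. *)
Definition nuclear_map (Q : tvsType K) (B : completeNormedModType K)
    (u : {linear Q -> B}) : Prop :=
  exists (lam : nat -> K) (f : nat -> {linear Q -> K^o}) (y : nat -> B),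
    [/\ cvgn [series `|lam n|]_n,
        equicontinuous [set: nat] (fun n => f n : Q -> K^o),
        bounded_fun y &
        forall x, [series (lam n * f n x) *: y n]_n @ \oo --> u x].

(* Grothendieck: a Hausdorff locally convex space is nuclear if all its
   continuous linear maps to Banach spaces are nuclear. *)
Definition nuclear_space (Q : tvsType K) : Prop :=
  hausdorff_space Q /\
  forall (B : completeNormedModType K) (u : {linear Q -> B}),
    continuous u -> nuclear_map u.

End FrechetSpaces.

(* Main.v *)
Require Import Defs.
From HB Require Import structures.
From mathcomp Require Import all_boot all_order all_algebra.
From mathcomp Require Import sesquilinear.
From mathcomp Require Import all_classical all_reals all_analysis.
From mathcomp.real_closed Require Import complex.
From mathcomp Require Import ring lra.

Set Implicit Arguments.
Unset Strict Implicit.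
Unset Printing Implicit Defensive.

Import Order.TTheory GRing.Theory Num.Theory.
Import numFieldNormedType.Exports.

Local Open Scope classical_set_scope.
Local Open Scope ring_scope.

(** Nuclearity is used through a single property: a continuous linear map from
    the nuclear space Q to a Banach space is an absolutely convergent series of
    rank-one maps. Such a map lifts through quotients of Banach spaces, and if
    its values lie in the closure of the range of some linear map iota, it is
    uniformly approximated by iota composed with maps of finite rank.

    All auxiliary Banach spaces are spaces of bounded scalar functions
    ([function_space], [bfun]). By the Hahn-Banach theorem a continuous linear
    map into l^oo(T) extends from a subspace coordinate by coordinate, and
    evaluation at the functionals dominated by a continuous seminorm s is a map
    into some l^oo whose norm is exactly s. Hence completions, quotients,
    operator spaces and projective seminorms are all obtained by evaluation at a
    suitable set of functionals or forms.

    Pro-local splitness ([extend_to_function_space]). Extend u : I -> B, for B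
    closed in l^oo(T), to a map from E into l^oo(T). Modulo B this extension
    vanishes on I, so it factors through a map from Q to l^oo(T)/B, which is
    nuclear and lifts to l^oo(T). Subtracting the lift moves the extension into
    B. For the tensored extension, a map from I (x) V to B is a bilinear map,
    that is, a map from I to a Banach space of operators from V to B, to which
    the same result applies ([extend_bilinear]).

    The tensored diagram is an extension ([tensored_extension]). The topology of
    a projective tensor product is given by the seminorms pi such that N <= pi
    as soon as N (t x y) <= s x * q y ([projective_seminorm]); so the tensor
    products are metrizable. Pro-local splitness for B = l^oo(polar of N) shows
    that I (x) V embeds topologically into E (x) V. The cokernel property comes
    from that of p, and the range of I (x) V is dense in the kernel by
    Hahn-Banach, hence equal to it by completeness.

    Ind-local splitness ([tensored_lift]). For an increasing sequence s n of
    seminorms defining E, the extension of I -> l^oo(polar (s n)) provides a map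
    sigma n from Q to the completion of E for s n that splits p modulo the
    closure of I. Two consecutive ones differ by a map into the closure of I.
    Both are approximated by maps of finite rank, and correcting the former by
    the latter yields continuous maps A n : Q -> E with s n (A n.+1 y - A n y)
    and r (p (A n y) - y) at most eps n * M n y, where M n does not depend on
    the sequence eps ([approximate_sections]). Given u : B -> Q (x) V, choose
    eps n small compared to the norm of u for the seminorm attached to M n; then
    (A n (x) id) o u converges uniformly on the unit ball to a lift of u. *)

(** * The Hahn-Banach theorem over the reals and the complex numbers *)

Section RealHahnBanach.
Variables (R : realType) (K : numFieldType) (rho : {rmorphism R -> K}).
Variables (E : lmodType K) (N : E -> R).
Hypothesis ND : forall x y, N (x + y) <= N x + N y.
Hypothesis NZ : forall t x, 0 <= t -> N (rho t *: x) = t * N x.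

(** A linear functional on an unspecified real subspace, bounded by N, given by
    its graph. Reals act through rho, so that E may be a complex space. *)
Definition dominated_graph (A : set (E * R)) :=
  [/\ A (0, 0),
      forall x r y q, A (x, r) -> A (y, q) -> A (x + y, r + q),
      forall t x r, A (x, r) -> A (rho t *: x, t * r) &
      forall x r, A (x, r) -> r <= N x].

(** The value c at z has to satisfy q - N (y - z) <= c <= N (y + z) - q' for all
    points of the graph; subadditivity of N makes the supremum of the left-hand
    sides a possible choice. *)
Lemma dominated_graph_extend (A : set (E * R)) (z : E) :
  dominated_graph A ->
  exists2 B, dominated_graph B & A `<=` B /\ exists c, B (z, c).
Proof.
move=> [A0 AD AZ AN].
pose L := [set r | exists y q, A (y, q) /\ r = q - N (y - z)].
have LU y q : A (y, q) -> ubound L (N (y + z) - q).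
  move=> Ayq _ [x [r [Axr ->]]].
  have := AN _ _ (AD _ _ _ _ Axr Ayq).
  have := ND (x - z) (y + z); rewrite addrACA addNr addr0; lra.
have L0 : L !=set0 by exists (0 - N (0 - z)), 0, 0.
have Lub : has_ubound L by exists (N (0 + z) - 0); exact: LU.
pose c := sup L.
have cu y q : A (y, q) -> q + c <= N (y + z).
  by move=> /LU/(ge_sup L0); rewrite -/c; lra.
have cl y q : A (y, q) -> q - c <= N (y - z).
  move=> Ayq; have : q - N (y - z) <= c by apply: ub_le_sup => //; exists y, q.
  lra.
exists [set u | exists y q t, A (y, q) /\ u = (y + rho t *: z, q + t * c)].
  split.
  - by exists 0, 0, 0; rewrite rmorph0 scale0r !addr0 mul0r addr0.
  - move=> _ _ _ _ [y [q [t [Ayq [-> ->]]]]] [y' [q' [t' [Ayq' [-> ->]]]]].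
    exists (y + y'), (q + q'), (t + t'); split; first exact: AD.
    by rewrite rmorphD scalerDl mulrDl; congr pair; rewrite addrACA.
  - move=> s _ _ [y [q [t [Ayq [-> ->]]]]].
    exists (rho s *: y), (s * q), (s * t); split; first exact: AZ.
    by rewrite scalerDr scalerA -rmorphM mulrDr mulrA.
  - move=> _ _ [y [q [t [Ayq [-> ->]]]]].
    have [t0|t0|->] := ltgtP t 0; last first.
    + by rewrite rmorph0 scale0r mul0r !addr0; exact: AN.
    + have := cu _ _ (AZ t^-1 _ _ Ayq); move/(ler_wpM2l (ltW t0)).
      rewrite -NZ; last exact: ltW.
      rewrite scalerDr scalerA -rmorphM mulrDr mulrA.
      by rewrite mulfV ?gt_eqF// rmorph1 scale1r mul1r.
    + have nt0 : 0 < - t by lra.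
      have := cl _ _ (AZ (- t)^-1 _ _ Ayq); move/(ler_wpM2l (ltW nt0)).
      rewrite -NZ; last exact: ltW.
      rewrite scalerBr scalerA -rmorphM mulrBr mulrA.
      rewrite mulfV ?gt_eqF// rmorph1 scale1r mul1r.
      by rewrite rmorphN scaleNr opprK mulNr opprK.
split; last by exists c, 0, 0, 1; rewrite !add0r mul1r rmorph1 scale1r.
by move=> [y q] Ayq; exists y, q, 0; rewrite rmorph0 scale0r mul0r !addr0.
Qed.

Lemma hahn_banach_real (A : set (E * R)) : dominated_graph A ->
  exists f : E -> R,
    [/\ forall x y, f (x + y) = f x + f y,
        forall t x, f (rho t *: x) = t * f x,
        forall x, f x <= N x &
        forall x r, A (x, r) -> f x = r].
Proof.
move=> dA.
(* Graphs are considered in union with A, so that the empty chain is bounded. *)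
have [] := @Zorn_bigcup _ [set B | dominated_graph (A `|` B)].
  move=> F FP Ftot /=.
  have Fdir X Y : F X -> F Y -> exists2 Z, F Z & X `|` Y `<=` Z.
    move=> FX FY; have [XY|YX] := Ftot _ _ FX FY.
      by exists Y => // x [/XY|].
    by exists X => // x [|/YX].
  have cov2 a b : (A `|` \bigcup_(X in F) X) a -> (A `|` \bigcup_(X in F) X) b ->
      exists B, [/\ dominated_graph B, B a, B b & B `<=` A `|` \bigcup_(X in F) X].
    have sub X : F X -> A `|` X `<=` A `|` \bigcup_(X in F) X.
      by move=> FX y [|Xy]; [left|right; exists X].
    case=> [Aa|[X FX Xa]] [Ab|[Y FY Yb]].
    + by exists A; split => //; left.
    + by exists (A `|` Y); split; [exact: FP|left|right|exact: sub].
    + by exists (A `|` X); split; [exact: FP|right|left|exact: sub].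
    + have [Z FZ XYZ] := Fdir _ _ FX FY.
      exists (A `|` Z); split; [exact: FP|right|right|exact: sub].
        by apply: XYZ; left.
      by apply: XYZ; right.
  split.
  + by left; case: dA.
  + move=> x r y q ha hb; have [B [[_ BD _ _] Ba Bb]] := cov2 _ _ ha hb.
    by apply; exact: BD.
  + move=> t x r ha; have [B [[_ _ BZ _] Ba _]] := cov2 _ _ ha ha.
    by apply; exact: BZ.
  + by move=> x r ha; have [B [[_ _ _ BN] Ba _ _]] := cov2 _ _ ha ha; exact: BN.
move=> M [/= dM Mmax].
have [G [dG AG Gtot]] : exists G, [/\ dominated_graph G, A `<=` G &
    forall z, exists c, G (z, c)].
  exists (A `|` M); split => //.
  move=> z; have [B dB [AMB [c Bc]]] := dominated_graph_extend z dM.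
  exists c; apply: contrapT => nc.
  apply: (Mmax B); last first.
    by rewrite /= (_ : A `|` B = B)//; apply/setUidPr => x Ax; apply: AMB; left.
  split; first by move=> x Mx; apply: AMB; right.
  by move=> BM; apply: nc; right; exact: BM.
case: (dG) => [G0 GD GZ GN].
have Gfun x r q : G (x, r) -> G (x, q) -> r = q.
  move=> Gr Gq.
  have N0 : N 0 = 0 by rewrite -(scale0r 0) -(rmorph0 rho) NZ// mul0r.
  have le0 r' q' : G (x, r') -> G (x, q') -> r' - q' <= 0.
    move=> Gr' /(GZ (-1)); rewrite rmorphN1 scaleN1r mulN1r => /(GD _ _ _ _ Gr').
    by rewrite subrr => /GN; rewrite N0.
  by apply/eqP; rewrite eq_le -(subr_le0 q) -(subr_le0 r) !le0.
exists (fun z => xget 0 [set c | G (z, c)]).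
have fG z : G (z, xget 0 [set c | G (z, c)]).
  by have [c Gc] := Gtot z; apply: (@xgetPex _ 0 [set c | G (z, c)]); exists c.
split.
- by move=> x y; apply: (Gfun (x + y)) => //; exact: GD.
- by move=> t x; apply: (Gfun (rho t *: x)) => //; exact: GZ.
- by move=> x; apply: GN.
- by move=> x r /AG Axr; apply: (Gfun x).
Qed.

End RealHahnBanach.

Definition mklin (K : numFieldType) (U V : lmodType K) (f : U -> V)
    (hf : linear f) : {linear U -> V} :=
  HB.pack f (GRing.isLinear.Build K U V *:%R f hf).

Definition mkbilin (K : numFieldType) (U V W : lmodType K) (f : U -> V -> W)
    (hl : forall v, linear (f^~ v)) (hr : forall u, linear (f u)) :
    {bilinear U -> V -> W} :=
  HB.pack f (bilinear_isBilinear.Build K U V W *:%R *:%R f (hl, hr)).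

Section Seminorms.
Variables (R : realType) (K : numFieldType) (nrm : K -> R).

Definition seminorm (E : lmodType K) (N : E -> R) : Prop :=
  (forall x y, N (x + y) <= N x + N y) /\
  (forall a x, N (a *: x) = nrm a * N x).

(** Extension along a linear map i rather than from a subspace: the bound by
    N \o i already forces phi to factor through the range of i. *)
Definition hahn_banach_property : Prop :=
  forall (I E : lmodType K) (i : {linear I -> E}) (N : E -> R)
    (phi : {linear I -> K^o}),
    seminorm N -> (forall x, nrm (phi x) <= N (i x)) ->
    exists2 psi : {linear E -> K^o},
      forall x, nrm (psi x) <= N x & forall x, psi (i x) = phi x.

End Seminorms.

(** The interface through which the real and the complex case are treated
    together. The modulus nrm and all seminorms below take their values in R,
    also for complex spaces. *)
Record scalars (R : realType) (K : numFieldType) := Scalars {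
  rho : {rmorphism R -> K};
  nrm : K -> R;
  rho_nrm : forall a, rho (nrm a) = `|a|;
  rho_le : forall x y, (rho x <= rho y) = (x <= y);
  scalar_complete : forall F : set_system K^o,
    ProperFilter F -> cauchy F -> cvg F;
  hahn_banach : hahn_banach_property nrm }.

Lemma hahn_banach_property_real (R : realType) :
  @hahn_banach_property R R (fun a => `|a|).
Proof.
move=> I E i N phi [ND NZ] phiN.
have [||f [fD fZ fN fi]] := @hahn_banach_real R R idfun E N ND _
    [set u | exists x, u = (i x, phi x)].
- by move=> t x t0; rewrite NZ ger0_norm.
- split.
  + by exists 0; rewrite !linear0.
  + by move=> _ _ _ _ [x [-> ->]] [y [-> ->]]; exists (x + y); rewrite !linearD.
  + by move=> t _ _ [x [-> ->]]; exists (t *: x); rewrite !linearZ.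
  + by move=> _ _ [x [-> ->]]; exact: le_trans (ler_norm _) (phiN x).
have flin : linear (f : E -> R^o) by move=> a x y; rewrite fD fZ.
exists (mklin flin) => x /=; last by apply: fi; exists x.
rewrite ler_norml fN andbT lerNl.
by have := fN (-1 *: x); rewrite fZ NZ normrN1 mulN1r mul1r.
Qed.

(** If f is a real-linear extension of the real part of phi, then
    f x - i f (i x) is a complex-linear extension of phi. Its modulus at x is
    its real part at a multiple of x by a number of modulus one, hence is still
    bounded by N. *)
Lemma hahn_banach_property_complex (R : realType) :
  @hahn_banach_property R R[i] (fun a => complex.Re `|a|).
Proof.
move=> I E i N phi [ND NZ] phiN.
have reN (a : R[i]) : complex.Re a <= complex.Re `|a|.
  have := normc_ge_Re a; rewrite normc_def lecR/=.
  by apply: le_trans; exact: ler_norm.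
have reD (a b : R[i]) : complex.Re (a + b) = complex.Re a + complex.Re b.
  by case: a b => ? ? [].
have reR t (a : R[i]) : complex.Re (t%:C%C * a) = t * complex.Re a.
  by case: a => ? ? /=; rewrite mul0r subr0.
have [||f [fD fZ fN fi]] := @hahn_banach_real R R[i] (real_complex R) E N ND _
    [set u | exists x, u = (i x, complex.Re (phi x))].
- by move=> t x t0; rewrite NZ ger0_norm ?ler0c.
- split.
  + by exists 0; rewrite !linear0.
  + move=> _ _ _ _ [x [-> ->]] [y [-> ->]]; exists (x + y).
    by rewrite (linearD i) (linearD phi) reD.
  + by move=> t _ _ [x [-> ->]]; exists (t%:C%C *: x); rewrite (linearZ_LR i) (linearZ_LR phi) reR.
  + by move=> _ _ [x [-> ->]]; exact: le_trans (reN _) (phiN x).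
pose g (x : E) : R[i]^o := (f x +i* - f ('i%C *: x))%C.
have fNN x : f (- x) = - f x.
  by have := fZ (-1) x; rewrite mulN1r rmorphN1 scaleN1r.
have gD x y : g (x + y) = g x + g y.
  by rewrite /g scalerDr !fD opprD.
have gZ a x : g (a *: x) = a *: g x.
  have -> : a *: x = ((complex.Re a)%:C%C *: x)
                     + (complex.Im a)%:C%C *: ('i%C *: x).
    by rewrite [in LHS](complexE a) scalerDl scalerA mulrC.
  have ii : 'i%C *: ('i%C *: x) = - x :> E.
    by rewrite scalerA -expr2 sqr_i scaleN1r.
  have comm t y : 'i%C *: (t%:C%C *: y) = t%:C%C *: ('i%C *: y) :> E.
    by rewrite !scalerA mulrC.
  rewrite /g scalerDr !comm !fD !fZ ii fNN.
  case: a => a b /=; rewrite /GRing.scale/=.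
  by apply/eqP; rewrite eq_complex/=; apply/andP; split; apply/eqP; ring.
have glin : linear g by move=> a x y; rewrite gD gZ.
have gE x : mklin glin x = g x by [].
exists (mklin glin) => x; rewrite gE.
  have [g0|g0] := eqVneq (g x) 0.
    rewrite g0 normr0/=; have := fN x; have := fN (-1 *: x).
    rewrite scaleN1r fNN -(scaleN1r x) NZ normrN1/= mul1r; lra.
  pose u := `|g x| / g x.
  have nu : `|u| = 1.
    by rewrite normrM normr_id normrV ?unitfE// divff ?normr_eq0.
  have : g (u *: x) = `|g x| by rewrite gZ /GRing.scale/= divfK.
  move/(congr1 (@complex.Re R)) => /= <-.
  by apply: le_trans (fN _) _; rewrite NZ nu mul1r.
rewrite /g -linearZ.
have fre y : f (i y) = complex.Re (phi y) by apply: fi; exists y.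
rewrite !fre (linearZ_LR phi) /GRing.scale/=.
by case: (phi x) => a b /=; rewrite mul0r mul1r sub0r opprK.
Qed.

Definition real_scalars (R : realType) : scalars R R.
Proof.
apply: (@Scalars R R idfun (fun a => `|a|)) => //.
- exact: R_complete.
- exact: hahn_banach_property_real.
Defined.

Lemma complex_complete (R : realType) (F : set_system R[i]^o) :
  ProperFilter F -> cauchy F -> cvg F.
Proof.
move=> FF /cauchy_ballP Fc; apply/cvg_ex.
have nle (a : R[i]) : `|complex.Re a|%:C%C <= `|a| /\ `|complex.Im a|%:C%C <= `|a|.
  split; first exact: normc_ge_Re.
  rewrite normc_def lecR -sqrtr_sqr ler_wsqrtr// lerDr sqr_ge0.
  by [].
have nle2 (a : R[i]) : `|a| <= (`|complex.Re a| + `|complex.Im a|)%:C%C.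
  rewrite [X in `|X|]complexE; apply: le_trans (ler_normD _ _) _.
  rewrite rmorphD/= normrM (_ : `|'i%C| = 1) ?mul1r; last first.
    by rewrite normc_def/= expr0n/= add0r expr1n sqrtr1.
  by rewrite !normc_def/= !expr0n/= !addr0 !sqrtr_sqr.
have part (h : R[i] -> R) : (forall a b, h (a - b) = h a - h b) ->
    (forall a, `|h a|%:C%C <= `|a|) -> exists l : R^o, h @ F --> l.
  move=> hB hle; apply/cvg_ex; apply: R_complete.
  apply/cauchy_ballP => e e0 /=.
  have e0' : (0 : R[i]) < e%:C%C by rewrite ltcR.
  have [[A B] /= [FA FB] AB] := Fc _ e0'.
  exists (h @` A, h @` B) => /=.
    by split; [apply: filterS FA|apply: filterS FB] => a Aa; exists a.
  move=> [_ _] [/= [a Aa <-] [b Bb <-]].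
  have := AB (a, b) (conj Aa Bb).
  rewrite -!ball_normE /= -hB => ab; rewrite -ltcR.
  exact: le_lt_trans (hle _) ab.
have [||x Fx] := part (@complex.Re R); [by case=> ? ? []|by move=> a; case: (nle a)|].
have [||y Fy] := part (@complex.Im R); [by case=> ? ? []|by move=> a; case: (nle a)|].
exists (x +i* y)%C; apply/fcvgrPdist_lt => e e0.
have eE : e = (complex.Re e)%:C%C by rewrite RRe_real// gtr0_real.
have e20 : 0 < complex.Re e / 2.
  by apply: divr_gt0 => //; move: e0; rewrite eE ltcR.
move/cvgrPdist_lt/(_ _ e20): Fx => Fx.
move/cvgrPdist_lt/(_ _ e20): Fy => Fy.
near=> a; apply: le_lt_trans (nle2 _) _.
rewrite eE ltcR.
have : `|x - complex.Re a| < complex.Re e / 2 by near: a.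
have : `|y - complex.Im a| < complex.Re e / 2 by near: a.
case: (a) => a1 a2 /=; lra.
Unshelve. all: by end_near. Qed.

Definition complex_scalars (R : realType) : scalars R R[i].
Proof.
apply: (@Scalars R R[i] (real_complex R) (fun a => complex.Re `|a|)).
- by move=> a; exact: RRe_real (normr_real a).
- by move=> x y; exact: lecR.
- exact: complex_complete.
- exact: hahn_banach_property_complex.
Defined.

(** * Scalars and seminorms *)

Section ScalarTheory.
Variables (R : realType) (K : numFieldType) (S : scalars R K).
Local Notation rho := (rho S).
Local Notation nrm := (nrm S).

Lemma rho_lt x y : (rho x < rho y) = (x < y).
Proof. by rewrite !lt_def rho_le (inj_eq (fmorph_inj rho)). Qed.

Lemma rho_ge0 x : (0 <= rho x) = (0 <= x).
Proof. by rewrite -(rmorph0 rho) rho_le. Qed.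

Lemma rho_gt0 x : (0 < rho x) = (0 < x).
Proof. by rewrite -(rmorph0 rho) rho_lt. Qed.

Lemma nrm_ge0 a : 0 <= nrm a.
Proof. by rewrite -rho_ge0 rho_nrm. Qed.

Lemma nrmM a b : nrm (a * b) = nrm a * nrm b.
Proof. by apply: (fmorph_inj rho); rewrite rmorphM !rho_nrm normrM. Qed.

Lemma nrmD a b : nrm (a + b) <= nrm a + nrm b.
Proof. by rewrite -(rho_le S) rmorphD !rho_nrm ler_normD. Qed.

Lemma nrm_rho t : 0 <= t -> nrm (rho t) = t.
Proof. by move=> t0; apply: (fmorph_inj rho); rewrite rho_nrm ger0_norm ?rho_ge0. Qed.

Lemma nrm0 : nrm 0 = 0. Proof. by rewrite -(rmorph0 rho) nrm_rho. Qed.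
Lemma nrm1 : nrm 1 = 1. Proof. by rewrite -(rmorph1 rho) nrm_rho. Qed.

Lemma nrmN a : nrm (- a) = nrm a.
Proof. by apply: (fmorph_inj rho); rewrite !rho_nrm normrN. Qed.

Lemma nrm_eq0 a : nrm a = 0 -> a = 0.
Proof. by move/(congr1 rho); rewrite rho_nrm rmorph0 => /normr0_eq0. Qed.

Lemma nrm_gt0 a : (0 < nrm a) = (a != 0).
Proof. by rewrite -rho_gt0 rho_nrm normr_gt0. Qed.

Lemma nrmV a : a != 0 -> nrm a^-1 = (nrm a)^-1.
Proof.
move=> a0; have na : nrm a != 0 by rewrite gt_eqF ?nrm_gt0.
by apply: (mulfI na); rewrite -nrmM !mulfV ?nrm1.
Qed.

Lemma nrm_le0 a : nrm a <= 0 -> a = 0.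
Proof. by move=> a0; apply: nrm_eq0; apply/eqP; rewrite eq_le a0 nrm_ge0. Qed.

Lemma nrm_small a : (forall e, 0 < e -> nrm a <= e) -> a = 0.
Proof. by move=> ae; apply/nrm_le0/ler_addgt0Pr => e /ae; rewrite add0r. Qed.

Lemma rho_nrm_pos e : 0 < e -> rho (nrm e) = e.
Proof. by move=> e0; rewrite rho_nrm gtr0_norm. Qed.

Lemma nrm_pos e : 0 < e -> 0 < nrm e.
Proof. by move=> e0; rewrite -rho_gt0 rho_nrm_pos. Qed.

End ScalarTheory.

Section SeminormTheory.
Variables (R : realType) (K : numFieldType) (S : scalars R K).
Local Notation rho := (rho S).
Local Notation nrm := (nrm S).
Local Notation seminorm := (seminorm nrm).

Section OneSpace.
Variables (E : lmodType K) (N : E -> R) (hN : seminorm N).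

Lemma semi0 : N 0 = 0.
Proof. by rewrite -(scale0r 0) hN.2 nrm0 mul0r. Qed.

Lemma semiN x : N (- x) = N x.
Proof. by rewrite -scaleN1r hN.2 nrmN nrm1 mul1r. Qed.

Lemma semi_ge0 x : 0 <= N x.
Proof. by have := hN.1 x (- x); rewrite subrr semi0 semiN; lra. Qed.

Lemma semiB x y : N (x - y) <= N x + N y.
Proof. by rewrite -(semiN y); exact: hN.1. Qed.

Lemma semiC x y : N (x - y) = N (y - x).
Proof. by rewrite -semiN opprB. Qed.

Lemma semi_tri y x z : N (x - z) <= N (x - y) + N (y - z).
Proof. by rewrite -[x - z](subrKA y); exact: hN.1. Qed.

Lemma semi_leB x y : N x <= N (x - y) + N y.
Proof. by rewrite -[x in N x](subrK y); exact: hN.1. Qed.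

Lemma semi_rho t x : 0 <= t -> N (rho t *: x) = t * N x.
Proof. by move=> t0; rewrite hN.2 nrm_rho. Qed.

Lemma semi_scale C : 0 <= C -> seminorm (fun x => C * N x).
Proof.
move=> C0; split=> [x y|a x]; last by rewrite hN.2 mulrCA.
by rewrite -mulrDr ler_wpM2l ?hN.1.
Qed.

Lemma semi_sum (J : eqType) (r : seq J) (F : J -> E) :
  N (\sum_(j <- r) F j) <= \sum_(j <- r) N (F j).
Proof.
elim/big_ind2: _ => [|x a y b xa yb|//]; first by rewrite semi0.
by apply: le_trans (hN.1 _ _) _; exact: lerD.
Qed.

Lemma semi_comp (F : lmodType K) (f : {linear F -> E}) : seminorm (N \o f).
Proof.
split=> [x y|a x] /=; first by rewrite linearD hN.1.
by rewrite linearZ_LR hN.2.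
Qed.

End OneSpace.

Lemma semiD (E : lmodType K) (N M : E -> R) :
  seminorm N -> seminorm M -> seminorm (fun x => N x + M x).
Proof.
move=> hN hM; split=> [x y|a x]; last by rewrite hN.2 hM.2 mulrDr.
by have := hN.1 x y; have := hM.1 x y; lra.
Qed.

(** Homogeneity follows from one inequality, applied to a and to its inverse. *)
Lemma seminorm_intro (E : lmodType K) (N : E -> R) :
  (forall x y, N (x + y) <= N x + N y) -> N 0 = 0 ->
  (forall a x, a != 0 -> N (a *: x) <= nrm a * N x) -> seminorm N.
Proof.
move=> ND N0 NZ; split=> // a x.
have [->|a0] := eqVneq a 0; first by rewrite scale0r nrm0 mul0r.
have ai0 : a^-1 != 0 by rewrite invr_eq0.
apply/eqP; rewrite eq_le NZ//=.
have := NZ a^-1 (a *: x) ai0; rewrite scalerA mulVf// scale1r nrmV//.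
by rewrite ler_pdivlMl// nrm_gt0.
Qed.

(** Inclusion of unit balls is the order of seminorms. *)
Lemma semi_dominated (E : lmodType K) (N M : E -> R) :
  seminorm N -> seminorm M -> (forall x, M x < 1 -> N x <= 1) ->
  forall x, N x <= M x.
Proof.
move=> hN hM NM x; apply/ler_addgt0Pr => e e0.
have c0 : 0 < M x + e by have := semi_ge0 hM x; lra.
have := NM (rho (M x + e)^-1 *: x).
have ci : 0 <= (M x + e)^-1 by rewrite invr_ge0 ltW.
rewrite (semi_rho hN _ ci) (semi_rho hM _ ci).
by rewrite ltr_pdivrMl// mulr1 ler_pdivrMl// mulr1; apply; lra.
Qed.

Lemma nrm_seminorm : seminorm (nrm : K^o -> R).
Proof. by split=> [x y|a x]; [exact: nrmD|exact: nrmM]. Qed.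

(** The norm of a normed module with its value taken in R instead of K. *)
Definition rnorm (V : normedModType K) (x : V) : R := nrm `|x|.

Lemma rho_rnorm (V : normedModType K) (x : V) : rho (rnorm x) = `|x|.
Proof. by rewrite rho_nrm normr_id. Qed.

Lemma rnorm_seminorm (V : normedModType K) : seminorm (@rnorm V).
Proof.
split=> [x y|a x].
  by rewrite -(rho_le S) rmorphD /= !rho_rnorm ler_normD.
by apply: (fmorph_inj rho); rewrite rmorphM /= !rho_rnorm rho_nrm normrZ.
Qed.

Lemma rnorm_eq0 (V : normedModType K) (x : V) : rnorm x = 0 -> x = 0.
Proof. by move/(congr1 rho); rewrite rho_rnorm rmorph0 => /normr0_eq0. Qed.

End SeminormTheory.

(** * Continuous seminorms of a locally convex space *)

Section ContinuousSeminorms.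
Variables (R : realType) (K : numFieldType) (S : scalars R K).
Local Notation rho := (rho S).
Local Notation nrm := (nrm S).
Local Notation seminorm := (seminorm nrm).

(** Continuous seminorms. They determine the topology of a locally convex space
    (see [csn_nbhsP]), so continuity, convergence, separation and metrizability
    are all expressed with them. *)
Definition csn (E : tvsType K) (N : E -> R) : Prop :=
  seminorm N /\ nbhs (0 : E) [set x | N x < 1].

Section OneSpace.
Variable E : tvsType K.
Implicit Types (N M : E -> R).

Lemma csn_lt N e : csn N -> 0 < e -> nbhs (0 : E) [set x | N x < e].
Proof.
move=> [hN nN] e0.
have r0 : rho e != 0 by rewrite gt_eqF ?rho_gt0.
apply: filterS (nbhs0Z r0 nN) => _ [x /= Nx <-].
by rewrite (semi_rho hN) ?ltW// -[ltRHS]mulr1 ltr_pM2l.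
Qed.

Lemma csn_nbhs N e x : csn N -> 0 < e -> nbhs x [set y | N (y - x) < e].
Proof.
move=> hN e0; apply: filterS (nbhsT x (csn_lt hN e0)) => _ [y /= Ny <-].
by rewrite addrAC subrr add0r.
Qed.

Lemma csn_le N M C : csn M -> seminorm N -> (forall x, N x <= C * M x) -> csn N.
Proof.
move=> hM hN NM; split => //.
have C0 : 0 < `|C| + 1 by rewrite ltr_wpDl.
have ci : 0 < (`|C| + 1)^-1 by rewrite invr_gt0.
apply: filterS (csn_lt hM ci) => x /=.
rewrite -[ltRHS]mulr1 ltr_pdivlMl// => h; apply: le_lt_trans (NM x) (le_lt_trans _ h).
by apply: ler_wpM2r; [exact: semi_ge0 hM.1 _|have := ler_norm C; lra].
Qed.

Lemma csnD N M : csn N -> csn M -> csn (fun x => N x + M x).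
Proof.
move=> hN hM; split; first exact: semiD hN.1 hM.1.
have h : (0 : R) < 1 / 2 by lra.
by apply: filterS2 (csn_lt hN h) (csn_lt hM h) => x /=; lra.
Qed.

Lemma csnZ N C : 0 <= C -> csn N -> csn (fun x => C * N x).
Proof. by move=> C0 hN; apply: (csn_le hN (semi_scale hN.1 C0) (C := C)). Qed.

Lemma absorbing (V : set E) x : nbhs (0 : E) V ->
  exists2 t, 0 < t & forall a, nrm a <= t -> V (a *: x).
Proof.
move=> nV; have := @scale_continuous K E (0, x) V; rewrite /= scale0r => /(_ nV).
move=> [[A B] /= [nA nB] AB].
have [e /= e0 eA] := nA.
exists (nrm e / 2) => [|a ae]; first by rewrite divr_gt0// nrm_pos.
apply: (AB (a, x)); split => /=; last exact: nbhs_singleton nB.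
apply: eA; rewrite /= sub0r normrN -[ltRHS](rho_nrm_pos S)// -(rho_nrm S) rho_lt.
by have := nrm_pos S e0; lra.
Qed.

Section Gauge.
Variables (V : set E) (nV : nbhs (0 : E) V).
Hypothesis Vbal : forall a x, nrm a <= 1 -> V x -> V (a *: x).
Hypothesis Vcvx : forall t s x y, 0 < t -> 0 < s -> t + s = 1 ->
  V x -> V y -> V (rho t *: x + rho s *: y).

Let gset x := [set t | 0 < t /\ V (rho t^-1 *: x)].
Let gauge x := inf (gset x).

Let gset0 x : gset x !=set0.
Proof.
have [t t0 tV] := absorbing x nV; exists t^-1; split; first by rewrite invr_gt0.
by rewrite invrK; apply: tV; rewrite nrm_rho// ltW.
Qed.

Let gset_lb x : has_inf (gset x).
Proof. by split; [exact: gset0|exists 0 => t [/ltW]]. Qed.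

Let gauge_le x t : gset x t -> gauge x <= t.
Proof. by move=> xt; apply: ge_inf => //; case: (gset_lb x). Qed.

Let gauge_adh x e : 0 < e -> exists2 t, gset x t & t < gauge x + e.
Proof. by move=> e0; exact: inf_adherent. Qed.

Let gauge_ge0 x : 0 <= gauge x.
Proof. by apply: lb_le_inf; [exact: gset0|move=> t [/ltW]]. Qed.

Let gaugeZ_le (a : K) x : a != 0 -> gauge (a *: x) <= nrm a * gauge x.
Proof.
move=> a0; have na : 0 < nrm a by rewrite nrm_gt0.
apply/ler_addgt0Pr => e e0.
have [t [t0 Vt] te] := @gauge_adh x (e / nrm a) (divr_gt0 e0 na).
have nat : gset (a *: x) (nrm a * t).
  split; first exact: mulr_gt0.
  have -> : rho (nrm a * t)^-1 *: (a *: x) = (a * rho (nrm a)^-1) *: (rho t^-1 *: x).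
    by rewrite !scalerA invfM rmorphM/= mulrC mulrA.
  apply: Vbal Vt.
  rewrite nrmM nrm_rho; last by rewrite invr_ge0 ltW.
  by rewrite divff ?gt_eqF.
apply: le_trans (gauge_le nat) _.
apply: (@le_trans _ _ (nrm a * (gauge x + e / nrm a))).
  by rewrite ler_pM2l// ltW.
by rewrite mulrDr mulrCA divff ?gt_eqF// mulr1.
Qed.

Let gauge_seminorm : seminorm gauge.
Proof.
apply: seminorm_intro gaugeZ_le => [x y|].
  apply/ler_addgt0Pr => e e0.
  have e2 : 0 < e / 2 by lra.
  have [t [t0 Vt] te] := @gauge_adh x _ e2.
  have [s [s0 Vs] se] := @gauge_adh y _ e2.
  have ts0 : 0 < t + s by lra.
  have : gset (x + y) (t + s).
    split=> //.
    have -> : rho (t + s)^-1 *: (x + y) =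
        rho (t / (t + s)) *: (rho t^-1 *: x) + rho (s / (t + s)) *: (rho s^-1 *: y).
      rewrite !scalerA -!rmorphM scalerDr.
      by congr (rho _ *: _ + rho _ *: _); field; apply/andP; split; lra.
    by apply: Vcvx => //; rewrite ?divr_gt0// -mulrDl divff ?gt_eqF.
  by move/gauge_le; lra.
apply/eqP; rewrite eq_le gauge_ge0 andbT; apply/ler_addgt0Pr => e e0.
rewrite add0r; apply: gauge_le; split => //.
by rewrite scaler0; exact: nbhs_singleton nV.
Qed.

(** The Minkowski functional of a convex balanced neighbourhood of 0. *)
Lemma gauge_csn : exists2 N, csn N & forall x, N x < 1 -> V x.
Proof.
exists gauge.
  split; first exact: gauge_seminorm.
  have r0 : rho (1 / 2) != 0 by rewrite gt_eqF// rho_gt0; lra.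
  apply: filterS (nbhs0Z r0 nV) => _ [x Vx <-] /=.
  rewrite (semi_rho gauge_seminorm); last lra.
  suff : gauge x <= 1 by lra.
  by apply: gauge_le; split=> //; rewrite invr1 rmorph1 scale1r.
move=> x gx; have [|t [t0 Vt] te] := @gauge_adh x (1 - gauge x); first lra.
rewrite -[x]scale1r -(rmorph1 rho) -(mulfV (lt0r_neq0 t0)) rmorphM -scalerA.
by apply: Vbal Vt; rewrite nrm_rho//; lra.
Qed.

End Gauge.

(** A convex neighbourhood b of 0 need not be balanced; the vectors all of whose
    multiples by scalars of modulus at most 1 belong to b form a smaller
    neighbourhood that is convex and balanced. *)
Lemma csn_basis (U : set E) : nbhs (0 : E) U ->
  exists2 N, csn N & forall x, N x < 1 -> U x.
Proof.
move=> nU; have [B Bcvx [Bop Bbase]] := @locally_convex K E.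
have [b [Bb b0] bU] := Bbase 0 U nU.
have nb : nbhs (0 : E) b by apply: open_nbhs_nbhs; split => //; exact: Bop.
pose V := [set x | forall a, nrm a <= 1 -> b (a *: x)].
have nV : nbhs (0 : E) V.
  have := @scale_continuous K E (0, 0) b; rewrite /= scale0r => /(_ nb).
  move=> [[A W] /= [nA nW] AW].
  have [e /= e0 eA] := nA.
  have e2 : e / 2 != 0 by rewrite gt_eqF// divr_gt0.
  apply: filterS (nbhs0Z e2 nW) => _ [x Wx <-] a a1 /=.
  rewrite scalerA; apply: (AW (_, x)); split => //=.
  apply: eA; rewrite /= sub0r normrN normrM (gtr0_norm (divr_gt0 e0 _))//.
  apply: (@le_lt_trans _ _ (1 * (e / 2))).
    rewrite ler_wpM2r//; first by rewrite ltW// divr_gt0.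
    by rewrite -(rho_nrm S) -(rmorph1 rho) rho_le.
  by rewrite mul1r ltr_pdivrMr// ltr_pMr// ltr1n.
have [||N hN NV] := @gauge_csn V nV.
- move=> a x a1 Vx c c1; rewrite scalerA; apply: Vx.
  by rewrite nrmM mulr_ile1// ?nrm_ge0.
- move=> t s x y t0 s0 ts Vx Vy a a1.
  have t01 : 0 <= rho t by rewrite rho_ge0 ltW.
  have t11 : rho t <= 1 by rewrite -(rmorph1 rho) rho_le; lra.
  have := Bcvx b (mem_set Bb) (a *: x) (a *: y) (Itv01 t01 t11)
    (mem_set (Vx a a1)) (mem_set (Vy a a1)).
  move/set_mem; congr (b _).
  rewrite -[LHS]/(rho t *: (a *: x) + (1 - rho t) *: (a *: y)).
  rewrite -(rmorph1 rho) -rmorphB -ts addrAC subrr add0r.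
  by rewrite scalerDr !scalerA !(mulrC a).
exists N => // x /NV Vx; apply: bU; rewrite -[x]scale1r; apply: Vx.
by rewrite nrm1.
Qed.

Lemma csn_nbhsP x (U : set E) : nbhs x U ->
  exists2 N, csn N & forall y, N (y - x) < 1 -> U y.
Proof.
move=> nU; have := nbhsB (- x) nU; rewrite addNr => /csn_basis[N hN NU].
exists N => // y /NU [z Uz]; rewrite addrC => /(canRL (subrK _)).
by rewrite subrK => <-.
Qed.

Lemma cvg_csnP (F : set_system E) x : Filter F ->
  F --> x <-> forall N e, csn N -> 0 < e -> F [set y | N (y - x) < e].
Proof.
move=> FF; split=> [Fx N e hN e0|FN U /csn_nbhsP[N hN NU]].
  exact: Fx (csn_nbhs _ hN e0).
by apply: filterS (FN N 1 hN ltr01) => y; exact: NU.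
Qed.

Lemma hausdorff_csnP :
  hausdorff_space E <-> forall x, (forall N, csn N -> N x = 0) -> x = 0.
Proof.
split=> [hE x Nx|sep x y].
  apply/esym/hE => A B /csn_nbhsP[N hN NA] nB.
  exists x; split; last exact: nbhs_singleton nB.
  by apply: NA; rewrite subr0 Nx.
move=> cl; apply/eqP; rewrite -subr_eq0; apply/eqP/sep => N hN.
apply/eqP; rewrite eq_le (semi_ge0 hN.1) andbT; apply/ler_addgt0Pr => e e0.
have e2 : 0 < e / 2 by lra.
have [z [/= zx zy]] := cl _ _ (csn_nbhs x hN e2) (csn_nbhs y hN e2).
have := semi_tri hN.1 z x y; rewrite (semiC hN.1 x z); lra.
Qed.

Lemma hausdorff_csn_eq x y : hausdorff_space E ->
  (forall N e, csn N -> 0 < e -> N (x - y) <= e) -> x = y.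
Proof.
move=> /hausdorff_csnP sep xy; apply/eqP; rewrite -subr_eq0; apply/eqP/sep => N hN.
apply/eqP; rewrite eq_le (semi_ge0 hN.1) andbT.
by apply/ler_addgt0Pr => e e0; rewrite add0r; exact: xy.
Qed.

End OneSpace.
End ContinuousSeminorms.

(** * Continuity and convergence in terms of seminorms *)

Section ContinuousMaps.
Variables (R : realType) (K : numFieldType) (S : scalars R K).
Local Notation rho := (rho S).
Local Notation nrm := (nrm S).
Local Notation seminorm := (seminorm nrm).
Local Notation csn := (@csn R K S _).

Lemma csn_comp (E F : tvsType K) (f : {linear E -> F}) (N : F -> R) :
  continuous f -> csn N -> csn (N \o f).
Proof.
move=> cf [hN nN]; split; first exact: semi_comp.
by have := cf 0 [set x | N x < 1]; rewrite linear0 => /(_ nN).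
Qed.

Lemma continuous_csn (E F : tvsType K) (f : {linear E -> F}) :
  (forall N, csn N -> exists2 M, csn M & forall x, N (f x) <= M x) ->
  continuous f.
Proof.
move=> h x U /(csn_nbhsP S)[N hN NU]; have [M hM NM] := h N hN.
apply: filterS (csn_nbhs x hM ltr01) => y /= My; apply: NU.
by rewrite -linearB; exact: le_lt_trans (NM _) My.
Qed.

(** Homogeneity in each variable turns the bound on a product of unit balls into
    a product of seminorms. *)
Lemma continuous_bilinear_csn (E F T : tvsType K) (t : {bilinear E -> F -> T})
    (N : T -> R) : continuous_bilinear t -> csn N ->
  exists M L, [/\ csn M, csn L & forall x y, N (t x y) <= M x * L y].
Proof.
move=> ct [hN nN]; have := ct (0, 0) [set z | N z < 1].
rewrite /= linear0l => /(_ nN) [[A B] /= [nA nB] AB].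
have [M hM MA] := csn_basis S nA; have [L hL LB] := csn_basis S nB.
exists M, L; split => // x y.
have key : forall x, M x < 1 -> forall y, N (t x y) <= L y.
  move=> x' Mx'; apply: (semi_dominated (semi_comp hN (t x')) hL.1) => y' Ly' /=.
  by apply/ltW/(AB (x', y')); split; [exact: MA|exact: LB].
have hNy := semi_comp hN (applyr t y).
have := semi_dominated (semi_scale hNy _) (semi_scale hM.1 _).
have [Ly0|Ly0] := eqVneq (L y) 0.
  have -> : N (t x y) = 0.
    apply/eqP; rewrite eq_le (semi_ge0 hN) andbT.
    have [c c0 cM] := absorbing S x (csn_lt hM ltr01).
    have := key (rho c *: x) (cM _ _) y; rewrite (nrm_rho _ (ltW c0)) => /(_ (lexx _)).
    by rewrite linearZl_LR (semi_rho hN _ (ltW c0)) Ly0 pmulr_rle0.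
  by move=> _; rewrite Ly0 mulr0.
have Lp : 0 < L y by rewrite lt_def Ly0 (semi_ge0 hL.1).
move/(_ (L y)^-1 1); rewrite invr_ge0 (ltW Lp) => /(_ isT ler01) /(_ _ x)/=.
rewrite mul1r ler_pdivrMl// mulrC; apply => x' Mx'.
by rewrite mul1r in Mx'; rewrite ler_pdivrMl// mulr1; exact: key.
Qed.

Lemma csn_continuous_bilinear (E F T : tvsType K) (t : {bilinear E -> F -> T}) :
  (forall N, csn N ->
     exists M L, [/\ csn M, csn L & forall x y, N (t x y) <= M x * L y]) ->
  continuous_bilinear t.
Proof.
move=> h [x y] U /(csn_nbhsP S)[N hN NU] /=.
have [M [L [hM hL NML]]] := h N hN.
(* The three terms of the expansion of t u v - t x y around (x, y) sum to at
   most 1 / 4 when u and v are at distance less than 1 / c. *)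
pose c := 4 * (1 + M x + L y).
have c1 : 4 <= c.
  by have := semi_ge0 hM.1 x; have := semi_ge0 hL.1 y; rewrite /c; lra.
have ci : 0 < c^-1 by rewrite invr_gt0; lra.
exists ([set u | M (u - x) < c^-1], [set v | L (v - y) < c^-1]).
  by split; [exact: csn_nbhs x hM ci|exact: csn_nbhs y hL ci].
move=> [u v] /= [ux vy]; apply: NU.
have -> : t u v - t x y = t (u - x) (v - y) + t (u - x) y + t x (v - y).
  by rewrite (linearBr t (u - x)) subrK (linearBl t) (linearBr t x) addrA subrK.
have h1 := NML (u - x) (v - y); have h2 := NML (u - x) y; have h3 := NML x (v - y).
have p1 : M (u - x) * L (v - y) <= c^-1 * c^-1.
  by apply: ler_pM; [exact: semi_ge0 hM.1 _|exact: semi_ge0 hL.1 _|exact: ltW|exact: ltW].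
have p2 : M (u - x) * L y <= c^-1 * L y.
  by apply: ler_wpM2r; [exact: semi_ge0 hL.1 _|exact: ltW].
have p3 : M x * L (v - y) <= M x * c^-1.
  by apply: ler_wpM2l; [exact: semi_ge0 hM.1 _|exact: ltW].
have cc : c * c^-1 = 1 by rewrite divff//; lra.
have := hN.1.1 (t (u - x) (v - y) + t (u - x) y) (t x (v - y)).
have := hN.1.1 (t (u - x) (v - y)) (t (u - x) y).
move: p1 p2 p3 cc ci; set d := c^-1 => p1 p2 p3 cc d0.
have q1 : d * d <= d by nra.
have q2 : 4 * (d + M x * d + d * L y) = c * d by rewrite {1}/c; ring.
rewrite cc in q2.
lra.
Qed.

End ContinuousMaps.

Section Convergence.
Variables (R : realType) (K : numFieldType) (S : scalars R K).
Local Notation rho := (rho S).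
Local Notation nrm := (nrm S).
Local Notation seminorm := (seminorm nrm).
Local Notation csn := (@csn R K S _).

Lemma cvg_near (E : tvsType K) (x : nat -> E) l N e :
  x @ \oo --> l -> csn N -> 0 < e -> \forall n \near \oo, N (x n - l) < e.
Proof. by move=> /(@cvg_csnP R K S E) h hN e0; exact: h. Qed.

Lemma limit_le (E : tvsType K) (x : nat -> E) l z N C :
  x @ \oo --> l -> csn N -> (\forall n \near \oo, N (x n - z) <= C) ->
  N (l - z) <= C.
Proof.
move=> xl hN xz; apply/ler_addgt0Pr => e e0.
have [n [/= h1 h2]] := @filter_ex _ \oo _ _ (filterI xz (cvg_near xl hN e0)).
by have := semi_tri hN.1 (x n) l z; rewrite (semiC hN.1 l (x n)); lra.
Qed.

Lemma series_le_limn (a : nat -> R) n :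
  (forall n, 0 <= a n) -> cvgn (series a) -> series a n <= limn (series a).
Proof.
move=> a0 ca; apply: nondecreasing_cvgn_le => //; apply/nondecreasing_seqP => m.
by rewrite -subr_ge0 seriesSB.
Qed.

Lemma limn_series_ge0 (a : nat -> R) :
  (forall n, 0 <= a n) -> cvgn (series a) -> 0 <= limn (series a).
Proof.
move=> a0 ca; apply: le_trans (series_le_limn 0 a0 ca).
by rewrite /series/= big_geq.
Qed.

Lemma half_expr_gt0 n : 0 < (1 / 2 : R) ^+ n.
Proof. by apply: exprn_gt0; lra. Qed.

Lemma half_expr_small e : 0 < e -> \forall n \near \oo, (1 / 2 : R) ^+ n < e.
Proof.
move=> e0; have : (fun n => (1 / 2 : R) ^+ n) @ \oo --> 0.
  by apply: cvg_expr; rewrite ger0_norm; lra.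
move/cvgr0Pnorm_lt => /(_ e e0); apply: filterS => n.
by rewrite ger0_norm// ltW// half_expr_gt0.
Qed.

Lemma half_expr_summable : cvgn (series (fun n => (1 / 2 : R) ^+ n)).
Proof.
have h : `|1 / 2 : R| < 1 by rewrite ger0_norm; lra.
have := is_cvg_geometric_series (a := 1) h.
rewrite (_ : geometric 1 (1 / 2) = fun n => (1 / 2 : R) ^+ n)//.
by apply/funext => n; rewrite /= mul1r.
Qed.

(** Completeness in the only form used for sequences: increments that are
    eventually dominated, in each seminorm, by a summable sequence. *)
Lemma cvg_summable (E : tvsType K) (a : nat -> R) (x : nat -> E) :
  tvs_complete E -> (forall n, 0 <= a n) -> cvgn (series a) ->
  (forall N, csn N -> exists C, \forall n \near \oo, N (x n.+1 - x n) <= C * a n) ->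
  exists l : E, x @ \oo --> l.
Proof.
move=> cE a0 ca hx; apply: cE.
apply/(@cvg_csnP R K S E) => N e hN e0.
have [C hC] := hx N hN.
pose D := `|C| + 1; have D0 : 0 < D by rewrite /D ltr_wpDl.
have sS n := series_le_limn n a0 ca.
have eD : 0 < e / 2 / D by rewrite !divr_gt0//; lra.
have /cvgrPdist_lt/(_ _ eD) ha := ca.
have [n0 _ /= h0] : \forall n \near \oo,
    `|limn (series a) - series a n| < e / 2 / D /\ N (x n.+1 - x n) <= C * a n.
  exact: filterI ha hC.
have tail k : N (x (n0 + k)%N - x n0) <= D * (series a (n0 + k)%N - series a n0).
  elim: k => [|k IH]; first by rewrite addn0 !subrr (semi0 hN.1) mulr0.
  have [_ hk] := h0 (n0 + k)%N (leq_addr _ _).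
  have hk' : C * a (n0 + k)%N <= D * a (n0 + k)%N.
    by rewrite ler_wpM2r// /D; have := ler_norm C; lra.
  rewrite addnS; have := semi_tri hN.1 (x (n0 + k)%N) (x (n0 + k).+1) (x n0).
  by have := seriesSB a (n0 + k)%N; nra.
have close n : (n0 <= n)%N -> N (x n - x n0) < e / 2.
  move=> /subnKC <-; apply: le_lt_trans (tail _) _.
  have [+ _] := h0 n0 (leqnn _); have := sS (n0 + (n - n0))%N; have := sS n0.
  move=> h1 h2; rewrite ger0_norm ?subr_ge0// ltr_pdivlMr// mulrC.
  by apply: le_lt_trans; rewrite ler_pM2l//; lra.
exists ([set x n | n in [set n | n0 <= n]%N], [set x n | n in [set n | n0 <= n]%N]).
  by split; exists n0 => // n /= n0n; exists n.
move=> [_ _] /= [[m /= mn0 <-] [n /= nn0 <-]]; rewrite subr0.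
have := semi_tri hN.1 (x n0) (x m) (x n); rewrite (semiC hN.1 (x n0) (x n)).
by have := close m mn0; have := close n nn0; lra.
Qed.

End Convergence.

Section Limits.
Variables (R : realType) (K : numFieldType) (S : scalars R K).
Local Notation rho := (rho S).
Local Notation nrm := (nrm S).
Local Notation seminorm := (seminorm nrm).
Local Notation csn := (@csn R K S _).

Lemma limit_linear (X : lmodType K) (E : tvsType K) (T : nat -> {linear X -> E}) :
  hausdorff_space E -> (forall x, exists l : E, T n x @[n --> \oo] --> l) ->
  exists L : {linear X -> E}, forall x, T n x @[n --> \oo] --> L x.
Proof.
move=> hE /choice[L TL].
have Llin : linear L.
  move=> a x y; apply: (hausdorff_csn_eq (S := S)) => // N e hN e0.
  pose d := e / (nrm a + 2).
  have a2 : 0 < nrm a + 2 by have := nrm_ge0 S a; lra.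
  have d0 : 0 < d by rewrite divr_gt0.
  have ed : e = d * (nrm a + 2) by rewrite /d divfK// gt_eqF.
  have [n [/= h1 [h2 h3]]] := @filter_ex _ \oo _ _ (filterI (cvg_near (TL x) hN d0)
    (filterI (cvg_near (TL y) hN d0) (cvg_near (TL (a *: x + y)) hN d0))).
  have -> : L (a *: x + y) - (a *: L x + L y) =
      (L (a *: x + y) - T n (a *: x + y)) + (a *: (T n x - L x) + (T n y - L y)).
    by rewrite linearP scalerBr (addrACA (a *: T n x)) -opprD addrA subrK.
  have := hN.1.1 (L (a *: x + y) - T n (a *: x + y))
    (a *: (T n x - L x) + (T n y - L y)).
  have := hN.1.1 (a *: (T n x - L x)) (T n y - L y).
  rewrite hN.1.2 (semiC hN.1 (L _)).
  have := nrm_ge0 S a; nra.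
by exists (mklin Llin).
Qed.

Definition seminorm_basis (E : tvsType K) (s : nat -> E -> R) : Prop :=
  [/\ forall n, csn (s n), forall n m x, (n <= m)%N -> s n x <= s m x &
      forall N, csn N -> exists n, forall x, N x <= s n x].

(** Partial sums make the seminorms increasing. *)
Lemma countable_seminorm_basis (E : tvsType K) :
  countable_basis0 E -> exists s, @seminorm_basis E s.
Proof.
move=> [B Bn Bb].
have /choice[s hs] n : exists s, csn s /\ forall x, s x < 1 -> B n x.
  by have [s hs sB] := csn_basis S (Bn n); exists s.
pose t n x := \sum_(k < n.+1) s k x.
have tS n x : t n.+1 x = t n x + s n.+1 x by rewrite /t big_ord_recr.
have s0 k x : 0 <= s k x by exact: semi_ge0 (hs k).1.1 x.
have st n x : s n x <= t n x.
  by rewrite /t big_ord_recr/= lerDr sumr_ge0.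
exists t; split.
- elim=> [|n IH].
    rewrite (_ : t 0%N = s 0%N); first exact: (hs 0%N).1.
    by apply/funext => x; rewrite /t big_ord1.
  rewrite (_ : t n.+1 = fun x => t n x + s n.+1 x); last exact/funext/tS.
  exact: csnD IH (hs _).1.
- move=> n m x; elim: m => [|m IH]; first by rewrite leqn0 => /eqP ->.
  rewrite leq_eqVlt => /predU1P[->//|]; rewrite ltnS => /IH; rewrite tS.
  by have := s0 m.+1 x; lra.
- move=> N hN; have [n Bsub] := Bb _ hN.2.
  exists n => x; apply: le_trans (st n x).
  apply: (semi_dominated hN.1 (hs n).1.1) => y sy.
  by apply/ltW/Bsub; exact: (hs n).2.
Qed.

Lemma seminorm_basis_countable (E : tvsType K) (s : nat -> E -> R) :
  (forall n, csn (s n)) -> (forall N, csn N -> exists n, forall x, N x <= s n x) ->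
  countable_basis0 E.
Proof.
move=> hs sb; exists (fun n => [set x | s n x < 1]); first by move=> n; exact: (hs n).2.
move=> U /(csn_basis S)[N hN NU]; have [n Ns] := sb N hN.
by exists n => x /= sx; apply: NU; exact: le_lt_trans (Ns x) sx.
Qed.

Section Normed.
Variable V : normedModType K.
Local Notation rnorm := (@rnorm R K S V).

Lemma nbhs_rnorm (x : V) (e : R) : 0 < e -> nbhs x [set y | rnorm (y - x) < e].
Proof.
move=> e0; apply/nbhs_normP; exists (rho e) => /=; first by rewrite rho_gt0.
by move=> y /=; rewrite -(rho_lt S) rho_rnorm distrC.
Qed.

Lemma rnorm_nbhs (x : V) (U : set V) : nbhs x U ->
  exists2 e : R, 0 < e & forall y, rnorm (y - x) < e -> U y.
Proof.
move=> /nbhs_normP[e /= e0 eU]; exists (nrm e); first exact: nrm_pos.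
by move=> y ye; apply: eU => /=; rewrite distrC -(rho_rnorm S) -(rho_nrm_pos S e0) rho_lt.
Qed.

Lemma cauchy_rnorm (F : set_system V) (e : R) : ProperFilter F -> cauchy F ->
  0 < e -> exists2 A, F A & forall x y, A x -> A y -> rnorm (x - y) < e.
Proof.
move=> FF /cauchy_ballP Fc e0.
have re : 0 < rho (e / 2) by rewrite rho_gt0; lra.
have [[A B] /= [FA FB] AB] := Fc _ re.
have [z Bz] := @filter_ex _ F FF _ FB.
have half x : A x -> rnorm (x - z) < e / 2.
  move=> Ax; have := AB (x, z) (conj Ax Bz).
  by rewrite -ball_normE /= -(rho_rnorm S) rho_lt.
exists A => // x y /half hx /half hy.
have := semi_tri (rnorm_seminorm S V) z x y.
rewrite (semiC (rnorm_seminorm S V) z y); lra.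
Qed.

Lemma cvg_rnorm (F : set_system V) (x : V) : Filter F ->
  (forall e, 0 < e -> F [set y | rnorm (x - y) < e]) -> F --> x.
Proof.
move=> FF h; apply/fcvgrPdist_lt => e e0.
apply: filterS (h _ (nrm_pos S e0)) => y /=.
by rewrite -(rho_lt S) rho_rnorm rho_nrm_pos.
Qed.

Lemma csn_rnorm : csn rnorm.
Proof.
split; first exact: rnorm_seminorm.
by have := nbhs_rnorm 0 ltr01; under eq_set do rewrite subr0.
Qed.

Lemma csn_le_rnorm N : csn N -> exists2 C, 0 <= C & forall x, N x <= C * rnorm x.
Proof.
move=> hN; have [e e0 eN] := rnorm_nbhs hN.2.
have ei : 0 <= e^-1 by rewrite invr_ge0 ltW.
exists e^-1 => //.
apply: (semi_dominated hN.1 (semi_scale (rnorm_seminorm S V) ei)) => x.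
by rewrite ltr_pdivrMl// mulr1 => xe; apply/ltW/eN; rewrite subr0.
Qed.

Lemma normed_hausdorff : hausdorff_space V.
Proof.
apply/(hausdorff_csnP S) => x; move/(_ _ csn_rnorm).
exact: rnorm_eq0.
Qed.

Lemma normed_countable_basis : countable_basis0 V.
Proof.
apply: (@seminorm_basis_countable _ (fun n x => n%:R * rnorm x)).
  by move=> n; apply: csnZ csn_rnorm.
move=> N /csn_le_rnorm[C C0 CN]; exists (Num.truncn C).+1 => x.
apply: le_trans (CN x) _; apply: ler_wpM2r; first exact: semi_ge0 csn_rnorm.1 _.
by rewrite ltW// truncnS_gt.
Qed.

End Normed.

Lemma banach_frechet (V : completeNormedModType K) : frechet_space V.
Proof.
split; last exact: normed_countable_basis.
split; first exact: normed_hausdorff.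
move=> F FF Fc; suff /cauchy_cvg Fl : cauchy F by exists (lim F).
apply/cauchy_ballP => e e0.
have := Fc [set z | rnorm S z < nrm e].
have ne := nrm_pos S e0.
move=> /(_ (csn_lt (csn_rnorm V) ne)) [[A B] /= [FA FB] AB].
exists (A, B) => //= -[x y] /= xy; have := AB (x, y) xy.
by rewrite -ball_normE /= -(rho_lt S) rho_rnorm rho_nrm_pos.
Qed.

Lemma scalar_frechet : frechet_space (K^o : tvsType K).
Proof.
split; last exact: (normed_countable_basis (K^o : normedModType K)).
split; first exact: (@normed_hausdorff (K^o : normedModType K)).
move=> F FF Fc; suff /(scalar_complete S) Fl : cauchy F by exists (lim F).
apply/cauchy_ballP => e e0.
have := Fc [set z | rnorm S (z : (K^o : normedModType K)) < nrm e].
have ne := nrm_pos S e0.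
move=> /(_ (csn_lt (csn_rnorm (K^o : normedModType K)) ne)) [[A B] /= [FA FB] AB].
exists (A, B) => //= -[x y] /= xy; have := AB (x, y) xy.
by rewrite -ball_normE /= -(rho_lt S) rho_rnorm rho_nrm_pos.
Qed.

Lemma csn_nrm : csn (nrm : K^o -> R).
Proof.
have := csn_rnorm (K^o : normedModType K); congr csn.
by apply/funext => x; apply: (fmorph_inj rho); rewrite rho_rnorm rho_nrm.
Qed.

Lemma continuous_functional (E : tvsType K) (f : {linear E -> K^o}) N :
  csn N -> (forall x, nrm (f x) <= N x) -> continuous f.
Proof.
move=> hN fN; apply: (continuous_csn (S := S)) => M hM.
have hM' : csn (M : (K^o : normedModType K) -> R) by exact: hM.
have [C C0 CM] := csn_le_rnorm hM'.
exists (fun x => C * N x); first exact: csnZ.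
move=> x; apply: le_trans (CM _) _; rewrite ler_wpM2l//.
apply: le_trans (fN x); rewrite -(rho_le S) rho_rnorm rho_nrm.
exact: lexx.
Qed.

(** A seminorm is the supremum of the functionals it dominates; this is the
    extension property for the line spanned by z. *)
Lemma hahn_banach_point (E : lmodType K) (N : E -> R) (z : E) : seminorm N ->
  exists2 phi : {linear E -> K^o},
    forall x, nrm (phi x) <= N x & phi z = rho (N z).
Proof.
move=> hN.
have lin1 : linear (fun c : K^o => c *: z) by move=> a x y; rewrite scalerDl scalerA.
have lin2 : linear (fun c : K^o => c * rho (N z) : K^o).
  by move=> a x y; rewrite mulrDl -mulrA.
have [|psi psiN psiE] := @hahn_banach R K S _ E (mklin lin1) N (mklin lin2) hN.
  by move=> c /=; rewrite nrmM nrm_rho ?(semi_ge0 hN)// hN.2.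
exists psi => //; have := psiE 1; rewrite /= scale1r => ->.
by rewrite mul1r.
Qed.

End Limits.

(** * Banach spaces of bounded functions *)

(** Subspaces of l^oo(T) that are closed for uniform convergence. They are Banach
    spaces for the sup norm: a Cauchy filter converges pointwise, uniformly, and
    its limit stays in the subspace. *)
Record function_space (R : realType) (K : numFieldType) (S : scalars R K)
    (T : Type) := FunctionSpace {
  fs_mem : set (T -> K^o);
  fs_mem0 : fs_mem (fun=> 0);
  fs_memP : forall a f g, fs_mem f -> fs_mem g -> fs_mem (fun t => a * f t + g t);
  fs_bounded : forall f, fs_mem f -> exists C, forall t, nrm S (f t) <= C;
  fs_closed : forall f : T -> K^o,
    (forall e, 0 < e -> exists2 g, fs_mem g & forall t, nrm S (f t - g t) <= e) ->
    fs_mem f }.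

Section BoundedFunctions.
Variables (R : realType) (K : numFieldType) (S : scalars R K).
Variables (T : Type) (G : function_space S T).
Local Notation rho := (rho S).
Local Notation nrm := (nrm S).

Definition fs_pred : {pred T -> K^o} := [pred f | `[< fs_mem G f >]].

Fact fs_submod : submod_closed fs_pred.
Proof.
split=> [|a f g /asboolP hf /asboolP hg]; apply/asboolP; first exact: fs_mem0.
exact: fs_memP.
Qed.

HB.instance Definition _ := GRing.isSubmodClosed.Build K (T -> K^o) fs_pred fs_submod.

Record bfun := BFun { bfun_val :> T -> K^o; _ : bfun_val \in fs_pred }.

HB.instance Definition _ := [isSub for bfun_val].
HB.instance Definition _ := [Choice of bfun by <:].
HB.instance Definition _ := [SubChoice_isSubLmodule of bfun by <:].

Lemma bfunD (f g : bfun) t : (f + g) t = f t + g t. Proof. by []. Qed.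
Lemma bfunZ a (f : bfun) t : (a *: f) t = a * f t. Proof. by []. Qed.
Lemma bfunB (f g : bfun) t : (f - g) t = f t - g t. Proof. by []. Qed.
Lemma bfun0 t : (0 : bfun) t = 0. Proof. by []. Qed.

Lemma bfun_sum (J : Type) (r : seq J) (F : J -> bfun) t :
  (\sum_(j <- r) F j) t = \sum_(j <- r) F j t.
Proof. by apply: (big_morph (fun f : bfun => f t : K)). Qed.

Lemma bfun_ext (f g : bfun) : (forall t, f t = g t) -> f = g.
Proof. by move=> fg; apply: val_inj; apply/funext. Qed.

Lemma bfun_mem (f : bfun) : fs_mem G f.
Proof. by case: f => f /= /asboolP. Qed.

Definition mkbfun (f : T -> K^o) (hf : fs_mem G f) : bfun := BFun (asboolT hf).

Definition supn (f : bfun) : R := sup [set nrm (f t) | t in setT].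

Lemma nrm_le_supn (f : bfun) t : nrm (f t) <= supn f.
Proof.
apply: ub_le_sup; last by exists t.
by have [C fC] := fs_bounded (bfun_mem f); exists C => _ [u _ <-].
Qed.

Lemma supn_le (f : bfun) C : 0 <= C -> (forall t, nrm (f t) <= C) -> supn f <= C.
Proof.
move=> C0 fC; have [t|/forallNP nT] := pselect (exists t : T, True); last first.
  rewrite /supn (_ : [set _ | _ in _] = set0) ?sup0//.
  by apply/seteqP; split=> // x [t _ _]; have := nT t.
case: t => t _; apply: ge_sup; first by exists (nrm (f t)), t.
by move=> _ [u _ <-].
Qed.

Lemma supn_ge0 (f : bfun) : 0 <= supn f.
Proof.
have [[t _]|/forallNP nT] := pselect (exists t : T, True).
  exact: le_trans (nrm_ge0 _ _) (nrm_le_supn f t).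
rewrite /supn (_ : [set _ | _ in _] = set0) ?sup0//.
by apply/seteqP; split=> // x [t _ _]; have := nT t.
Qed.

Lemma supn_seminorm : seminorm nrm supn.
Proof.
apply: seminorm_intro => [f g||a f _].
- apply: supn_le => [|t]; first by rewrite addr_ge0// supn_ge0.
  rewrite bfunD; apply: le_trans (nrmD _ _ _) _.
  by apply: lerD; exact: nrm_le_supn.
- apply/eqP; rewrite eq_le supn_ge0 andbT; apply: supn_le => // t.
  by rewrite bfun0 nrm0.
- apply: supn_le => [|t]; first by rewrite mulr_ge0// ?nrm_ge0// supn_ge0.
  by rewrite bfunZ nrmM ler_wpM2l ?nrm_ge0// nrm_le_supn.
Qed.

Let norm (f : bfun) : K := rho (supn f).

Let normD f g : norm (f + g) <= norm f + norm g.
Proof. by rewrite /norm -rmorphD rho_le; exact: supn_seminorm.1. Qed.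

Let normZ a f : norm (a *: f) = `|a| * norm f.
Proof. by rewrite /norm supn_seminorm.2 rmorphM/= rho_nrm. Qed.

Let norm0_eq0 f : norm f = 0 -> f = 0.
Proof.
rewrite /norm -(rmorph0 rho) => /(fmorph_inj rho) f0.
apply: bfun_ext => t; apply: (nrm_le0 (S := S)).
by rewrite -f0 nrm_le_supn.
Qed.

HB.instance Definition _ := Lmodule_isNormed.Build K bfun normD normZ norm0_eq0.

Lemma rnorm_bfun (f : bfun) : rnorm S f = supn f.
Proof. by apply: (fmorph_inj rho); rewrite rho_rnorm. Qed.

Lemma bfun_complete (F : set_system bfun) : ProperFilter F -> cauchy F -> cvg F.
Proof.
move=> FF Fc; apply/cvg_ex.
have Fc' (e : R) : 0 < e ->
    exists2 A, F A & forall f g, A f -> A g -> forall t, nrm (f t - g t) < e.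
  move=> e0; have [A FA AA] := cauchy_rnorm S FF Fc e0.
  exists A => // f g Af Ag t; apply: le_lt_trans (AA f g Af Ag).
  by rewrite rnorm_bfun; exact: (nrm_le_supn (f - g) t).
have lim t : exists l : K^o, (fun f : bfun => f t : K^o) @ F --> l.
  apply/cvg_ex; apply: (scalar_complete S).
  apply/cauchy_ballP => e e0.
  have [A FA AA] := Fc' _ (nrm_pos S e0).
  pose At := (fun f : bfun => f t : K^o) @` A.
  have FAt : F [set f : bfun | At (f t)].
    by apply: (@filterS _ F _ A) => // f Af; exists f.
  exists (At, At) => /=; first by split; exact: FAt.
  move=> [_ _] [/= [f Af <-] [g Ag <-]].
  rewrite -ball_normE /= -[ltRHS](rho_nrm_pos S e0) -(rho_nrm S) rho_lt.
  exact: AA.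
have [l Fl] := choice lim.
have close (e : R) (A : set bfun) : 0 < e -> F A ->
    (forall f g, A f -> A g -> forall t, nrm (f t - g t) < e) ->
    forall f, A f -> forall t, nrm (l t - f t) <= e.
  move=> e0 FA AA f Af t; apply/ler_addgt0Pr => d d0.
  have rd : 0 < rho d by rewrite rho_gt0.
  have := Fl t; move/cvgrPdist_lt => /(_ _ rd) h.
  have [g [/= gl Ag]] := @filter_ex _ F FF _ (filterI h FA).
  have g1 : nrm (l t - g t) < d by rewrite -(rho_lt S) rho_nrm.
  have g2 := AA _ _ Ag Af t.
  have := nrmD S (l t - g t) (g t - f t); rewrite subrKA; lra.
have lG : fs_mem G l.
  apply: fs_closed => e e0; have [A FA AA] := Fc' _ e0.
  have [f Af] := @filter_ex _ F FF _ FA.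
  by exists f; [exact: bfun_mem|exact: close e0 FA AA f Af].
exists (mkbfun lG); apply: (cvg_rnorm (S := S)) => e e0.
have e2 : 0 < e / 2 by lra.
have [A FA AA] := Fc' _ e2.
apply: (filterS _ FA) => f Af; rewrite /= rnorm_bfun.
apply: (@le_lt_trans _ _ (e / 2)); last by lra.
by apply: supn_le => [|t]; [exact: ltW|exact: (close _ _ e2 FA AA f Af t)].
Qed.

HB.instance Definition _ := Uniform_isComplete.Build bfun bfun_complete.

Lemma supn_csn : csn S supn.
Proof. by have := csn_rnorm S bfun; congr csn; apply/funext/rnorm_bfun. Qed.

Lemma continuous_to_bfun (E : tvsType K) (f : {linear E -> bfun}) N :
  csn S N -> (forall x t, nrm (f x t) <= N x) -> continuous f.
Proof.
move=> hN fN; apply: (continuous_csn (S := S)) => M hM.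
have [C C0 CM] := csn_le_rnorm hM.
exists (fun x => C * N x); first exact: csnZ.
move=> x; apply: le_trans (CM _) _; rewrite ler_wpM2l// rnorm_bfun.
by apply: supn_le => //; exact: semi_ge0 hN.1 _.
Qed.

End BoundedFunctions.

Section FunctionSpaces.
Variables (R : realType) (K : numFieldType) (S : scalars R K) (T : Type).
Local Notation rho := (rho S).
Local Notation nrm := (nrm S).

Definition linfty : function_space S T.
Proof.
apply: (@FunctionSpace _ _ S T
  [set f : T -> K^o | exists C, forall t, nrm (f t) <= C]).
- by exists 0 => t; rewrite nrm0.
- move=> a f g [C fC] [D gD]; exists (nrm a * C + D) => t.
  apply: le_trans (nrmD _ _ _) _; rewrite nrmM lerD//.
  by rewrite ler_wpM2l ?nrm_ge0.
- by [].
- move=> f h; have [g [C gC] fg] := h 1 ltr01.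
  exists (1 + C) => t; rewrite -[f t](subrK (g t)).
  by apply: le_trans (nrmD _ _ _) _; exact: lerD.
Defined.

(** Nuclear representations of a map only have their vectors in a Banach space
    containing its values; taking the closure of the range of f as target makes
    these vectors approximable by values of f. *)
Definition closure_range (X : lmodType K) (f : {linear X -> bfun linfty}) :
  function_space S T.
Proof.
apply: (@FunctionSpace _ _ S T
  [set g : T -> K^o | forall e, 0 < e -> exists x, forall t, nrm (g t - f x t) <= e]).
- by move=> e e0; exists 0 => t; rewrite linear0 subrr nrm0 ltW.
- move=> a g h hg hh e e0.
  have a2 : 0 < nrm a + 1 by have := nrm_ge0 S a; lra.
  have d0 : 0 < e / (nrm a + 1) by rewrite divr_gt0.
  have [x gx] := hg _ d0; have [y hy] := hh _ d0; exists (a *: x + y) => t.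
  rewrite linearP bfunD bfunZ.
  have -> : a * g t + h t - (a * f x t + f y t) =
      a * (g t - f x t) + (h t - f y t) by ring.
  apply: le_trans (nrmD _ _ _) _; rewrite nrmM.
  apply: (@le_trans _ _ (nrm a * (e / (nrm a + 1)) + e / (nrm a + 1))).
    by apply: lerD => //; rewrite ler_wpM2l ?nrm_ge0.
  by rewrite -[X in _ + X]mul1r -mulrDl mulrC divfK ?gt_eqF.
- move=> g hg; have [x gx] := hg 1 ltr01.
  exists (1 + supn (f x)) => t; rewrite -[g t](subrK (f x t)).
  by apply: le_trans (nrmD _ _ _) _; apply: lerD => //; exact: nrm_le_supn.
- move=> g hg e e0; have e2 : 0 < e / 2 by lra.
  have [h hh gh] := hg _ e2; have [x hx] := hh _ e2; exists x => t.
  rewrite -[g t - _](subrKA (h t)).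
  apply: le_trans (nrmD _ _ _) _.
  by have := gh t; have := hx t; lra.
Defined.

End FunctionSpaces.

(** * Kernels and cokernels of Frechet spaces *)

Section InducedTopology.
Variables (K : numFieldType) (I : lmodType K) (E : tvsType K).
Variable i : {linear I -> E}.

(** I with the topology induced from E: the topological subspace ker p when i is
    a kernel of p. *)
Definition induced : Type := initial_topology i.

HB.instance Definition _ := GRing.Lmodule.copy induced I.
HB.instance Definition _ := Uniform.copy induced (initial_topology i).

Lemma nbhs_induced (x : induced) (U : set induced) :
  nbhs x U <-> exists2 V, nbhs (i x) V & forall y : induced, V (i y) -> U y.
Proof.
split=> [[W [[B Bop <-] Bx BU]]|[V nV VU]].
  by exists B => [|y By]; [exact: open_nbhs_nbhs|exact: BU].
move: nV; rewrite nbhsE => -[B [Bop Bx] BV].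
by exists (i @^-1` B); split => [||y By]; [exists B|exact: Bx|exact/VU/BV].
Qed.

Lemma induced_add_continuous : continuous (fun x : induced * induced => x.1 + x.2).
Proof.
move=> [x y] U /nbhs_induced[V nV VU].
have := @add_continuous E (i x, i y) V; rewrite /= -linearD => /(_ nV).
move=> [[A B] /= [nA nB] AB].
exists (i @^-1` A, i @^-1` B).
  by split; apply/nbhs_induced; [exists A|exists B].
move=> [u v] /= [Au Bv]; apply: VU; rewrite linearD.
exact: (AB (i u, i v)).
Qed.

Lemma induced_scale_continuous : continuous (fun z : K^o * induced => z.1 *: z.2).
Proof.
move=> [a x] U /nbhs_induced[V nV VU].
have := @scale_continuous K E (a, i x) V; rewrite /= -linearZ_LR => /(_ nV).
move=> [[A B] /= [nA nB] AB].
exists (A, i @^-1` B).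
  by split => //; apply/nbhs_induced; exists B.
move=> [c u] /= [Ac Bu]; apply: VU; rewrite linearZ_LR.
exact: (AB (c, i u)).
Qed.

Lemma induced_locally_convex : exists2 B : set_system induced,
  (forall b, b \in B -> convex_set b) & basis B.
Proof.
have [B Bcvx [Bop Bbase]] := @locally_convex K E.
exists [set b | exists2 c, B c & b = i @^-1` c].
  move=> b; rewrite inE => -[c Bc ->] x y t xc yc; apply/mem_set => /=.
  have := Bcvx c (mem_set Bc) (i x) (i y) t (mem_set (set_mem xc)) (mem_set (set_mem yc)).
  by move/set_mem; congr (c _); rewrite /conv/= linearD !linearZ_LR.
split=> [_ [c Bc ->]|x U /nbhs_induced[V nV VU]].
  by exists c => //; exact: Bop.
have [c [Bc cx] cV] := Bbase _ _ nV.
by exists (i @^-1` c); [split => //; exists c|move=> y cy; apply: VU; exact: cV].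
Qed.

HB.instance Definition _ :=
  PreTopologicalNmodule_isTopologicalNmodule.Build induced induced_add_continuous.
HB.instance Definition _ :=
  TopologicalNmodule_isTopologicalLmodule.Build K induced induced_scale_continuous.
HB.instance Definition _ := Uniform_isTvs.Build K induced induced_locally_convex.

End InducedTopology.

Section Kernels.
Variables (R : realType) (K : numFieldType) (S : scalars R K).
Local Notation csn := (@csn R K S _).

(** The kernel property tested on the one-dimensional space. *)
Lemma kernel_exact (I E Q : tvsType K) (i : {linear I -> E}) (p : {linear E -> Q}) :
  hausdorff_space E -> frechet_kernel i p ->
  injective i /\ forall y, p y = 0 -> exists x, i x = y.
Proof.
move=> hE [pi ker].
have lin (F : tvsType K) (y : F) : linear (fun c : K^o => c *: y).
  by move=> a x z; rewrite scalerDl scalerA.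
have cont (F : tvsType K) (y : F) : continuous (mklin (lin F y) : K^o -> F).
  apply: (continuous_csn (S := S)) => N hN; exists (fun c => N y * nrm S c).
    by apply: csnZ; [exact: semi_ge0 hN.1 _|exact: csn_nrm].
  by move=> c /=; rewrite hN.1.2 mulrC.
have lift (y : E) : p y = 0 -> exists2 x, i x = y & forall x', i x' = y -> x' = x.
  move=> py; have [|g [cg ig gu]] := ker K^o (mklin (lin E y)) (scalar_frechet S) (cont E y).
    by move=> c /=; rewrite linearZ_LR py scaler0.
  exists (g 1); first by rewrite ig /= scale1r.
  move=> x' ix'; have := gu (mklin (lin I x')) (cont I x') _ 1.
  by rewrite /= scale1r; apply => w /=; rewrite linearZ_LR ix'.
split=> [x x' xx'|y py]; last by have [x] := lift y py; exists x.
have [|z _ zu] := lift (i x'); first exact: pi.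
by rewrite (zu x)// (zu x').
Qed.

(** A kernel is a topological embedding: ker p is closed in E, so I with the
    induced topology is again a Frechet space W, and the kernel property for
    W -> E says that the identity from W to I is continuous. *)
Lemma kernel_embedding (I E Q : tvsType K) (i : {linear I -> E}) (p : {linear E -> Q})
    (N : I -> R) :
  frechet_space E -> hausdorff_space Q -> continuous i -> continuous p ->
  frechet_kernel i p -> csn N ->
  exists2 M, csn M & forall x, N x <= M (i x).
Proof.
move=> [[hE cE] bE] hQ ci cp ik hN.
have [iinj iker] := kernel_exact hE ik.
have [pi ker] := ik.
pose W : tvsType K := induced i.
have jlin : linear (i : W -> E) by move=> a x y; rewrite linearP.
pose j : {linear W -> E} := mklin jlin.
have cj : continuous j.
  move=> x U nU; apply/(@nbhs_induced K I E i x); exists U => //.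
have cvgW (F : set_system W) x : Filter F -> i @ F --> i x -> F --> (x : W).
  move=> FF Fx U /(@nbhs_induced K I E i x)[V nV VU].
  have FV : F [set y | V (i y)] by exact: Fx nV.
  by apply: (filterS _ FV) => y /= Vy; exact: VU.
have fW : frechet_space W.
  split; [split|].
  - move=> x y; have hxy := hE (i x) (i y) => cl; apply: iinj; apply: hxy => A B nA nB.
    have [z [/= zA zB]] := cl _ _ (cj x _ nA) (cj y _ nB).
    by exists (i z).
  - move=> F FF Fc.
    have [|y Fy] := cE (i @ F) _.
      move=> U nU; have : nbhs (0 : W) (j @^-1` U) by apply: cj; rewrite linear0.
      move/Fc => [[A B] /= [FA FB] AB].
      exists (i @` A, i @` B).
        by split; [apply: filterS FA|apply: filterS FB] => x Ax; exists x.
      move=> [_ _] [/= [x Ax <-] [z Bz <-]]; rewrite -linearB.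
      exact: (AB (x, z)).
    have [x ix] : exists x, i x = y.
      apply: iker; apply: hQ => A B nA nB.
      have nB' : nbhs y (p @^-1` A) by exact: cp.
      have [x Ax] := @filter_ex _ F FF _ (Fy _ nB').
      exists 0; split; last exact: nbhs_singleton nB.
      by move: Ax; rewrite /= pi.
    by exists x; apply: cvgW; rewrite ix.
  - have [B nB Bb] := bE; exists (fun n => i @^-1` B n).
      by move=> n; apply: (cj 0); rewrite linear0.
    move=> U /(@nbhs_induced K I E i (0 : W))[V nV VU].
    rewrite linear0 in nV; have [n BV] := Bb V nV.
    by exists n => x Bx; apply: VU; exact: BV.
have [g [cg ig _]] := ker W j fW cj (fun x => pi x).
have gid x : g x = x by apply: iinj; exact: ig.
have hNg := csn_comp cg hN.
have [V nV VN] := (@nbhs_induced K I E i (0 : W) _).1 hNg.2.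
rewrite linear0 in nV; have [M hM MV] := csn_basis S nV.
exists M => //; apply: (semi_dominated hN.1 (semi_comp hM.1 i)) => x Mx.
by apply/ltW; rewrite -[x]gid; apply: VN; exact: MV.
Qed.

(** The range of p is dense, expressed without topology. *)
Lemma cokernel_epi (I E Q W : tvsType K) (i : {linear I -> E}) (p : {linear E -> Q})
    (g h : {linear Q -> W}) :
  frechet_cokernel i p -> frechet_space W -> continuous p -> 
  continuous g -> continuous h -> (forall x, g (p x) = h (p x)) -> g =1 h.
Proof.
move=> [pi cok] fW cp cg ch gh.
have clin : linear (fun x => g (p x)) by move=> a x y; rewrite !linearP.
have cgp : continuous (mklin clin).
  by move=> x; apply: continuous_comp; [exact: cp|exact: cg].
have [|k [ck kp ku]] := cok W (mklin clin) fW cgp.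
  by move=> x /=; rewrite pi linear0.
by move=> y; rewrite (ku g cg)// (ku h ch)// => x; rewrite /= gh.
Qed.

End Kernels.

(** * Quotients of Banach spaces and nuclear maps *)

Section QuotientSeminorm.
Variables (R : realType) (K : numFieldType) (S : scalars R K).
Local Notation rho := (rho S).
Local Notation nrm := (nrm S).
Local Notation seminorm := (seminorm nrm).

Definition linear_subspace (E : lmodType K) (G : set E) : Prop :=
  G 0 /\ forall a x y, G x -> G y -> G (a *: x + y).

Lemma quotient_seminorm (E : lmodType K) (N : E -> R) (G : set E) :
  seminorm N -> linear_subspace G ->
  exists2 d : E -> R, seminorm d &
    [/\ forall x, d x <= N x, forall x, G x -> d x = 0 &
        forall x e, 0 < e -> exists2 g, G g & N (x - g) < d x + e].
Proof.
move=> hN [G0 GP].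
have GD x y : G x -> G y -> G (x + y).
  by move=> Gx Gy; rewrite -[x]scale1r; exact: GP.
have GZ a x : G x -> G (a *: x).
  by move=> Gx; rewrite -[a *: x]addr0; exact: GP.
pose D x := [set r | exists2 g, G g & r = N (x - g)].
have D0 x : D x !=set0 by exists (N (x - 0)), 0.
have Dlb x : has_inf (D x).
  by split => //; exists 0 => _ [g _ ->]; exact: semi_ge0 hN _.
pose d x := inf (D x).
have dle x g : G g -> d x <= N (x - g).
  by move=> Gg; apply: ge_inf; [case: (Dlb x)|exists g].
have dadh x e : 0 < e -> exists2 g, G g & N (x - g) < d x + e.
  by move=> e0; have [_ [g Gg ->] h] := inf_adherent e0 (Dlb x); exists g.
have dge0 x : 0 <= d x.
  by apply: lb_le_inf => // _ [g _ ->]; exact: semi_ge0 hN _.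
have dG x : G x -> d x = 0.
  move=> Gx; apply/eqP; rewrite eq_le dge0 andbT.
  by have := dle x x Gx; rewrite subrr (semi0 hN).
have dZ_le a x : a != 0 -> d (a *: x) <= nrm a * d x.
  move=> _; apply/ler_addgt0Pr => e e0.
  have a1 : 0 < nrm a + 1 by have := nrm_ge0 S a; lra.
  have d0 : 0 < e / (nrm a + 1) by rewrite divr_gt0.
  have [g Gg xg] := dadh x _ d0.
  apply: le_trans (dle _ _ (GZ a _ Gg)) _; rewrite -scalerBr hN.2.
  apply: (@le_trans _ _ (nrm a * (d x + e / (nrm a + 1)))).
    by apply: ler_wpM2l; [exact: nrm_ge0|exact: ltW].
  rewrite mulrDr lerD2l mulrCA -[leRHS]mulr1 ler_wpM2l ?(ltW e0)//.
  by rewrite ler_pdivrMr// mul1r; lra.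
exists d; last by split => // x; have := dle x 0 G0; rewrite subr0.
apply: seminorm_intro dZ_le => [x y|]; last exact: dG.
apply/ler_addgt0Pr => e e0; have e2 : 0 < e / 2 by lra.
have [g Gg xg] := dadh x _ e2; have [h Gh yh] := dadh y _ e2.
have := dle (x + y) (g + h) (GD _ _ Gg Gh).
by rewrite opprD addrACA; have := hN.1 (x - g) (y - h); lra.
Qed.

End QuotientSeminorm.

Section Annihilator.
Variables (R : realType) (K : numFieldType) (S : scalars R K).
Variables (V : completeNormedModType K) (G : set V).
Hypothesis Gsub : linear_subspace G.
Local Notation rho := (rho S).
Local Notation nrm := (nrm S).
Local Notation rnorm := (@rnorm R K S V).

Definition annihilator := {phi : {linear V -> K^o} |
  (forall v, nrm (phi v) <= rnorm v) /\ (forall v, G v -> phi v = 0)}.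

(** Duality between subspaces and quotients: the functionals of norm at most 1
    that vanish on G compute the distance to G. *)
Lemma annihilator_distance (v : V) (C e : R) : 0 < e ->
  0 <= C -> (forall phi : annihilator, nrm (sval phi v) <= C) ->
  exists2 g, G g & rnorm (v - g) < C + e.
Proof.
move=> e0 C0 vC; have [d hd [dN dG dadh]] := quotient_seminorm (rnorm_seminorm S V) Gsub.
have [phi phid phiv] := hahn_banach_point v hd.
have phiP : (forall v, nrm (phi v) <= rnorm v) /\ (forall v, G v -> phi v = 0).
  split=> [w|w Gw]; first exact: le_trans (phid w) (dN w).
  by apply: (nrm_le0 (S := S)); have := phid w; rewrite dG.
have := vC (exist _ phi phiP); rewrite /= phiv nrm_rho ?(semi_ge0 hd)// => dC.
by have [g Gg vg] := dadh v e e0; exists g => //; lra.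
Qed.

Lemma annihilator_eval_mem (v : V) :
  fs_mem (linfty S annihilator) (fun phi => sval phi v).
Proof. by exists (rnorm v) => phi; case: (svalP phi). Qed.

Lemma annihilator_eval_linear :
  linear (fun v => mkbfun (annihilator_eval_mem v)).
Proof.
move=> a x y; apply: bfun_ext => phi.
by rewrite bfunD bfunZ; exact: (linearP (sval phi)).
Qed.

(** A model of the projection of V onto V / G: by [annihilator_distance] the
    sup norm of the value at v is the quotient norm. *)
Definition annihilator_eval : {linear V -> bfun (linfty S annihilator)} :=
  mklin annihilator_eval_linear.

(** The model V / G of [annihilator_eval] is complete: a limit h of values of
    the projection is the sum of a series of small differences, each of which
    lifts to a small vector. This is why h itself has a preimage, and that
    preimage can be corrected by an element of G to have norm close to that
    of h. *)
Lemma annihilator_eval_lift (h : bfun (closure_range annihilator_eval)) (C : R) :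
  (forall phi, nrm (h phi) <= C) -> 0 <= C ->
  exists2 v : V, forall phi : annihilator, sval phi v = h phi & rnorm v <= C + 1.
Proof.
move=> hC C0.
have e_gt0 n := half_expr_gt0 R n.
have /choice[x hx] n : exists x : V, forall phi : annihilator, nrm (h phi - sval phi x) <= (1 / 2) ^+ n.
  by have [x hx] := bfun_mem h _ (e_gt0 n); exists x => phi; exact: hx.
have /choice[d hd] n : exists d, (forall phi : annihilator,
    sval phi d = sval phi (x n.+1) - sval phi (x n)) /\ rnorm d <= 3 * (1 / 2) ^+ n.
  have [| |g Gg hg] := @annihilator_distance (x n.+1 - x n) (2 * (1 / 2) ^+ n) _ (e_gt0 n).
  - by rewrite mulr_ge0// ltW.
  - move=> phi; rewrite linearB /= -(subrKA (h phi)).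
    apply: le_trans (nrmD _ _ _) _; have := hx n phi; have := hx n.+1 phi.
    by rewrite exprS -(nrmN S (sval phi _ - h phi)) opprB; have := e_gt0 n; lra.
  exists (x n.+1 - x n - g); split; last by have := e_gt0 n; lra.
  by move=> phi; rewrite !linearB /= ((svalP phi).2 g Gg) subr0.
(* z n and x n have the same class modulo G, but z converges. *)
pose z n := x 0%N + \sum_(0 <= k < n) d k.
have zS n : z n.+1 - z n = d n.
  by rewrite /z big_nat_recr//= opprD addrACA subrr add0r addrAC subrr add0r.
have phiz n (phi : annihilator) : sval phi (z n) = sval phi (x n).
  elim: n => [|n IH]; first by rewrite /z big_geq// addr0.
  by rewrite -[z n.+1](subrK (z n)) zS linearD IH (hd n).1 subrK.
have [v zv] : exists v : V, z @ \oo --> v.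
  apply: (cvg_summable (S := S) (a := fun n => (1 / 2) ^+ n)).
  - exact: (banach_frechet S V).1.2.
  - by move=> n; exact: ltW.
  - exact: half_expr_summable.
  - move=> N /csn_le_rnorm[D D0 ND]; exists (D * 3); apply: nearW => n.
    rewrite zS; apply: le_trans (ND _) _; rewrite -mulrA ler_wpM2l//.
    exact: (hd n).2.
have phiv (phi : annihilator) : sval phi v = h phi.
  apply/eqP; rewrite -subr_eq0; apply/eqP/(nrm_small (S := S)) => e e0.
  have e2 : 0 < e / 2 by lra.
  have [n [/= h1 h2]] := @filter_ex _ \oo _ _
    (filterI (cvg_near zv (csn_rnorm S V) e2) (half_expr_small e2)).
  have h3 := (svalP phi).1 (z n - v); rewrite linearB phiz in h3.
  have := nrmD S (sval phi v - sval phi (x n)) (sval phi (x n) - h phi).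
  rewrite subrKA -[nrm (sval phi v - sval phi _)](nrmN S) opprB.
  rewrite -[nrm (_ - h phi) in leRHS](nrmN S) opprB.
  by have := hx n phi; lra.
have [|g Gg vg] := @annihilator_distance v C 1 ltr01 C0.
  by move=> phi; rewrite phiv.
exists (v - g); last exact: ltW.
by move=> phi; rewrite linearB ((svalP phi).2 g Gg) subr0 phiv.
Qed.

End Annihilator.

Section NuclearMaps.
Variables (R : realType) (K : numFieldType) (S : scalars R K).
Local Notation rho := (rho S).
Local Notation nrm := (nrm S).
Local Notation csn := (@csn R K S _).

Lemma bounded_rnorm (T : Type) (V : normedModType K) (y : T -> V) :
  bounded_fun y -> exists2 D, 0 <= D & forall t, rnorm S (y t) <= D.
Proof.
move=> [M [Mreal hM]]; exists (nrm (`|M| + 1)); first exact: nrm_ge0.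
have M1 : 0 <= `|M| + 1 by rewrite addr_ge0.
move=> t; rewrite -(rho_le S) rho_rnorm rho_nrm (ger0_norm M1).
by apply: hM => //; apply: le_lt_trans (real_ler_norm Mreal) _; rewrite ltrDl.
Qed.

(** The summable coefficients are absorbed into the functionals, whose
    equicontinuity is a common dominating continuous seminorm. *)
Lemma nuclear_series (Q : tvsType K) (B : completeNormedModType K)
    (u : {linear Q -> B}) : nuclear_map u ->
  exists (mu : nat -> R) (f : nat -> {linear Q -> K^o}) (y : nat -> B)
      (M : Q -> R) (C : R),
    [/\ (forall n, 0 <= mu n) /\ cvgn (series mu), csn M,
        forall n x, nrm (f n x) <= mu n * M x, 
        0 <= C /\ forall n, rnorm S (y n) <= C &
        forall x, series (fun n => f n x *: y n) @ \oo --> u x].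
Proof.
move=> [lam [f [y [lamc feq ybd fyu]]]].
have [M hM fM] : exists2 M, csn M & forall n x, nrm (f n x) <= M x.
  pose A : set (K^o * K^o) := [set ab | ball ab.1 1 ab.2].
  have eA : entourage A.
    by rewrite -entourage_ballE; exists 1 => //=.
  have := feq 0 A eA => nA.
  have [M hM MA] := csn_basis S nA.
  exists M => // n; apply: (semi_dominated (semi_comp (nrm_seminorm S) (f n)) hM.1).
  move=> x /MA /(_ n I); rewrite /A /= linear0 -ball_normE /= sub0r normrN.
  by rewrite -(rho_le S) rho_nrm rmorph1 => /ltW.
have flin n : linear (fun x => lam n * f n x : K^o).
  by move=> a x z; rewrite linearP mulrDr /GRing.scale/= mulrCA.
have [D D0 yD] := bounded_rnorm ybd.
exists (fun n => nrm (lam n)), (fun n => mklin (flin n)), y, M, D; split => //.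
- split=> [n|]; first exact: nrm_ge0.
  have rs n : rho (series (fun n => nrm (lam n)) n) = series (fun n => `|lam n|) n.
    by rewrite /series/= rmorph_sum; apply: eq_bigr => k _; rewrite rho_nrm.
  apply: nondecreasing_is_cvgn.
    by apply/nondecreasing_seqP => n; rewrite -subr_ge0 seriesSB nrm_ge0.
  have [C _ hC] := bounded_rnorm (cvg_seq_bounded (V := K^o) lamc).
  exists C => _ [n _ <-]; apply: le_trans (hC n).
  by rewrite -(rho_le S) rs rho_rnorm; exact: real_ler_norm (ger0_real (sumr_ge0 _ _)).
- by move=> n x /=; rewrite nrmM ler_wpM2l ?nrm_ge0.
Qed.

(** The vectors of a nuclear representation lift to bounded vectors, and the
    series with these vectors still converges. *)
Lemma nuclear_lift (Q : tvsType K) (V B : completeNormedModType K)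
    (k : {linear V -> B}) (u : {linear Q -> B}) :
  continuous k -> nuclear_map u ->
  (forall y C, rnorm S y <= C -> 0 <= C ->
     exists2 v, k v = y & rnorm S v <= C + 1) ->
  exists2 s : {linear Q -> V}, continuous s & forall x, k (s x) = u x.
Proof.
move=> ck nu klift.
have [mu [f [y [M [C [[mu0 mucv] hM fM [C0 yC] fyu]]]]]] := nuclear_series nu.
have /choice[z hz] n : exists z, k z = y n /\ rnorm S z <= C + 1.
  by have [z kz zC] := klift (y n) C (yC n) C0; exists z.
have Tlin n : linear (fun x => series (fun n => f n x *: z n) n).
  move=> a x x'; rewrite /series/= scaler_sumr -big_split /=.
  by apply: eq_bigr => j _; rewrite linearP scalerDl scalerA.
have TS n x N : csn N -> N (mklin (Tlin n.+1) x - mklin (Tlin n) x) <= (N (z n) * M x) * mu n.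
  move=> hN; rewrite /= seriesSB hN.1.2 mulrAC mulrC -mulrA mulrC.
  by rewrite mulrC ler_wpM2l ?(semi_ge0 hN.1)// mulrC.
have M0 x : 0 <= M x by exact: semi_ge0 hM.1 x.
have bnd N : csn N -> exists2 D, 0 <= D & forall n x,
    N (mklin (Tlin n.+1) x - mklin (Tlin n) x) <= D * M x * mu n.
  move=> hN; have [D D0 ND] := csn_le_rnorm hN; exists (D * (C + 1)).
    by rewrite mulr_ge0//; lra.
  move=> n x; apply: le_trans (TS n x N hN) _; rewrite ler_wpM2r// ler_wpM2r//.
  by apply: le_trans (ND _) _; rewrite ler_wpM2l//; exact: (hz n).2.
have [||s Ts] := @limit_linear R K S Q V (fun n => mklin (Tlin n)).
- exact: (banach_frechet S V).1.1.
- move=> x; apply: (cvg_summable (S := S) (a := mu)) => //.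
    exact: (banach_frechet S V).1.2.
  by move=> N /bnd[D _ ND]; exists (D * M x); apply: nearW => n; exact: ND.
exists s.
  apply: (continuous_csn (S := S)) => N hN; have [D D0 ND] := bnd N hN.
  have muS n := series_le_limn n mu0 mucv.
  have A0 := limn_series_ge0 mu0 mucv.
  exists (fun x => D * limn (series mu) * M x); first exact: csnZ (mulr_ge0 D0 A0) hM.
  move=> x; rewrite -[s x]subr0; apply: (limit_le (Ts x) hN); apply: nearW => n.
  rewrite subr0.
  apply: (@le_trans _ _ (D * M x * series mu n)); last first.
    by rewrite mulrAC ler_wpM2r// ler_wpM2l.
  elim: n => [|n IH]; first by rewrite /= /series/= !big_geq// (semi0 hN.1) mulr0.
  rewrite -[mklin (Tlin n.+1) x](subrK (mklin (Tlin n) x)).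
  apply: le_trans (hN.1.1 _ _) _.
  by have := ND n x; have := seriesSB mu n; nra.
move=> x; apply: (@cvg_unique _ _ (series (fun n => f n x *: y n) @ \oo)).
- exact: (banach_frechet S B).1.1.
- have -> : series (fun n => f n x *: y n) = k \o (fun n => mklin (Tlin n) x).
    apply/funext => n; rewrite /= /series/= linear_sum.
    by apply: eq_bigr => j _; rewrite linearZ_LR (hz j).1.
  by apply: cvg_comp (Ts x) _; exact: ck.
- exact: fyu.
Qed.

End NuclearMaps.

(** * Extension of maps and of bilinear maps to Banach spaces *)

Section CoordinateMaps.
Variables (R : realType) (K : numFieldType) (S : scalars R K).
Variables (X : lmodType K) (T : Type) (G : function_space S T).
Variable f : X -> T -> K^o.
Hypotheses (fl : forall t, linear (f^~ t)) (fG : forall x, fs_mem G (f x)).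

Lemma bfun_lin_subproof : linear (fun x => mkbfun (fG x)).
Proof.
move=> a x y; apply: bfun_ext => t; rewrite bfunD bfunZ.
exact: fl.
Qed.

Definition bfun_lin : {linear X -> bfun G} := mklin bfun_lin_subproof.

End CoordinateMaps.

Section ExtensionOfMaps.
Variables (R : realType) (K : numFieldType) (S : scalars R K).
Local Notation rho := (rho S).
Local Notation nrm := (nrm S).
Local Notation csn := (@csn R K S _).

(** An extension with nuclear quotient is pro-locally split. The map ut extends u
    to a map into l^oo(T); its class w modulo G vanishes on I, so it comes from
    Q, and s is a lift of this map; then ut - s \o p takes values in G. *)
Theorem extend_to_function_space (I E Q : tvsType K) (i : {linear I -> E})
    (p : {linear E -> Q}) (T : Type) (G : function_space S T)
    (u : {linear I -> bfun G}) :
  frechet_extension i p -> nuclear_space Q -> continuous u ->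
  exists2 l : {linear E -> bfun G}, continuous l & forall x, l (i x) = u x.
Proof.
move=> [[fI fE fQ] [ci cp ik pc]] [hQ nQ] cu.
have [M hM uM] : exists2 M, csn M & forall x, supn (u x) <= M (i x).
  by apply: (kernel_embedding fE hQ ci cp ik); exact: csn_comp cu (supn_csn G).
have ulin t : linear (fun x => u x t : K^o).
  by move=> a x y; rewrite linearP bfunD bfunZ.
have /choice[psi psiP] t : exists psi : {linear E -> K^o},
    (forall x, nrm (psi x) <= M x) /\ forall x, psi (i x) = u x t.
  have [|psi psiM psiu] := @hahn_banach R K S _ _ i M (mklin (ulin t)) hM.1.
    by move=> x; apply: le_trans (uM x); exact: (nrm_le_supn (u x) t).
  by exists psi.
have utl t : linear (fun x => psi t x) by exact: linearP.
have utm x : fs_mem (linfty S T) (fun t => psi t x).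
  by exists (M x) => t; exact: (psiP t).1.
pose ut := bfun_lin utl utm.
have cut : continuous ut.
  by apply: (continuous_to_bfun hM) => x t; exact: (psiP t).1.
have uti x t : ut (i x) t = u x t by exact: (psiP t).2.
pose Gs : set (bfun (linfty S T)) := [set f | fs_mem G f].
have Gsub : linear_subspace Gs.
  by split=> [|a f g Gf Gg]; [exact: (fs_mem0 G)|exact: (fs_memP a Gf Gg)].
pose A := annihilator S Gs.
have kl (phi : A) : linear (fun v : bfun (linfty S T) => sval phi v).
  exact: linearP.
have km v : fs_mem (closure_range (annihilator_eval S Gs))
    (fun phi : A => sval phi v).
  by move=> e e0; exists v => phi; rewrite [X in nrm X]subrr nrm0 ltW.
pose k := bfun_lin kl km.
have ck : continuous k.
  apply: (continuous_to_bfun (csn_rnorm S (bfun (linfty S T)))) => v phi.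
  exact: (svalP phi).1.
have wlin : linear (fun x => k (ut x)) by move=> a x y; rewrite !linearP.
pose w0 := mklin wlin.
have cw0 : continuous w0.
  by move=> x; apply: continuous_comp; [exact: cut|exact: ck].
have w0i x : w0 (i x) = 0.
  have utG : fs_mem G (bfun_val (ut (i x))).
    rewrite (_ : bfun_val (ut (i x)) = bfun_val (u x)); first exact: bfun_mem.
    by apply/funext => t; exact: uti.
  by apply: bfun_ext => phi; rewrite bfun0; apply: (svalP phi).2.
have [w [cw wp _]] := pc.2 _ w0
  (banach_frechet S (bfun (closure_range (annihilator_eval S Gs)))) cw0 w0i.
have [s cs ks] : exists2 s : {linear Q -> bfun (linfty S T)},
    continuous s & forall x, k (s x) = w x.
  apply: (nuclear_lift ck (nQ _ w cw)) => y C yC C0.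
  have [|v vy vC] := annihilator_eval_lift Gsub (h := y) (C := C) _ C0.
    move=> phi; apply: le_trans (nrm_le_supn y phi) _.
    by rewrite -rnorm_bfun; exact: yC.
  by exists v => //; apply: bfun_ext => phi; exact: vy.
have l0lin : linear (fun x => ut x - s (p x)).
  by move=> a x y; rewrite (linearP ut) (linearP p) (linearP s) scalerBr opprD addrACA.
pose l0 := mklin l0lin.
have cl0 : csn (fun x => supn (ut x) + supn (s (p x))).
  apply: csnD; first exact: csn_comp cut (supn_csn _).
  exact: csn_comp cp (csn_comp cs (supn_csn _)).
have l0G x : fs_mem G (l0 x).
  apply: fs_closed => e e0.
  have [|g Gg xg] := @annihilator_distance R K S _ Gs Gsub (l0 x) 0 e e0 (lexx _).
    move=> phi; rewrite [sval phi _](_ : _ = 0) ?nrm0// /l0 /=.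
    rewrite linearB; apply/eqP; rewrite subr_eq0; apply/eqP.
    have := congr1 (fun f : bfun _ => f phi) (wp x).
    by rewrite -ks => h; exact: esym h.
  exists g => // t.
  apply: le_trans (ltW _); last by move: xg; rewrite add0r; exact.
  by rewrite rnorm_bfun; exact: (nrm_le_supn (l0 x - g) t).
have ll t : linear (fun x => l0 x t).
  by move=> a x y; rewrite linearP bfunD bfunZ.
exists (bfun_lin ll l0G).
  apply: (continuous_to_bfun cl0) => x t.
  apply: le_trans (nrm_le_supn (l0 x) t) _.
  by rewrite -!rnorm_bfun; exact: semiB (rnorm_seminorm S _) _ _.
move=> x; apply: bfun_ext => t.
rewrite -[LHS]/(ut (i x) t - s (p (i x)) t) uti (pc.1 x) linear0 bfun0.
by rewrite subr0.
Qed.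

(** Unlike in [semi_dominated] the constant may be 0, in which case N vanishes. *)
Lemma semi_dominated_scale (E : lmodType K) (N L : E -> R) C :
  seminorm nrm N -> seminorm nrm L -> 0 <= C ->
  (forall x, L x <= 1 -> N x <= C) -> forall x, N x <= C * L x.
Proof.
move=> hN hL C0 NL x.
have step D : 0 < D -> C <= D -> N x <= D * L x.
  move=> D0 CD; have Di : 0 <= D^-1 by rewrite invr_ge0 ltW.
  rewrite -ler_pdivrMl//.
  apply: (semi_dominated (semi_scale hN Di) hL) => y Ly.
  by rewrite ler_pdivrMl// mulr1; apply: le_trans CD; apply: NL; exact: ltW.
have L0 := semi_ge0 hL x.
apply/ler_addgt0Pr => e e0.
have L1 : 0 < L x + 1 by lra.
have d0 : 0 < e / (L x + 1) by rewrite divr_gt0.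
apply: le_trans (step (C + e / (L x + 1)) _ _) _; [lra|lra|].
rewrite mulrDl lerD2l mulrAC ler_pdivrMr//; nra.
Qed.

Lemma functional_bound (B : normedModType K) (y : B) C : 
  (forall phi : {linear B -> K^o}, (forall z, nrm (phi z) <= rnorm S z) ->
     nrm (phi y) <= C) -> rnorm S y <= C.
Proof.
have hN := rnorm_seminorm S B.
have [phi phiN phiy] := hahn_banach_point y hN.
by move=> /(_ phi phiN); rewrite phiy nrm_rho// (semi_ge0 hN).
Qed.

Section OperatorSpace.
Variables (V : lmodType K) (L : V -> R) (B : completeNormedModType K).
Hypothesis hL : seminorm nrm L.
Local Notation rnorm := (@rnorm R K S _).

(** The operators c : V -> B that are bounded for the seminorm L are encoded by
    the functions (v, phi) |-> phi (c v) on the product of the unit balls of V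
    and of the dual of B; the sup norm of this function is the operator norm. *)
Definition op_index : Type :=
  ({v : V | L v <= 1} * {phi : {linear B -> K^o} | forall y, nrm (phi y) <= rnorm y})%type.

Definition op_coord (c : V -> B) (t : op_index) : K^o := sval t.2 (c (sval t.1)).

Lemma op_bound (c : V -> B) C : (forall t, nrm (op_coord c t) <= C) ->
  forall v, L v <= 1 -> rnorm (c v) <= C.
Proof.
move=> cC v Lv; apply: functional_bound => phi phiN.
exact: (cC (exist _ v Lv, exist _ phi phiN)).
Qed.

Definition operators : function_space S op_index.
Proof.
apply: (@FunctionSpace _ _ S op_index [set f | exists2 c : {linear V -> B},
  (exists C, forall t, nrm (f t) <= C) & forall t, f t = op_coord c t]).
- exists \0; first by exists 0 => t; rewrite nrm0.
  by move=> t; rewrite /op_coord linear0.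
- move=> a f g [c [C fC] fc] [d [D gD] gd].
  exists (a \*: c \+ d : {linear V -> B}).
    exists (nrm a * C + D) => t; apply: le_trans (nrmD _ _ _) _.
    by rewrite nrmM lerD// ler_wpM2l ?nrm_ge0.
  by move=> t; rewrite fc gd /op_coord /= linearP.
- by move=> f [c [C fC] _]; exists C.
- move=> f hf.
  have e_gt0 n := half_expr_gt0 R n.
  have /choice[c hc] n : exists c : {linear V -> B},
      forall t, nrm (f t - op_coord c t) <= (1 / 2) ^+ n.
    have [g [c _ gc] fg] := hf _ (e_gt0 n).
    by exists c => t; rewrite -gc.
  have [C fC] : exists C, forall t, nrm (f t) <= C.
    have [g [_ [C gC] _] fg] := hf 1 ltr01; exists (1 + C) => t.
    rewrite -[f t](subrK (g t)); apply: le_trans (nrmD _ _ _) _.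
    exact: lerD.
  have cS n v : rnorm (c n.+1 v - c n v) <= (2 * (1 / 2) ^+ n) * L v.
    pose d : {linear V -> B} := c n.+1 \- c n.
    apply: (semi_dominated_scale (semi_comp (rnorm_seminorm S B) d) hL).
      by rewrite mulr_ge0// ltW.
    move=> x Lx; apply: (@op_bound d) => // t.
    rewrite /op_coord /= linearB /=.
    rewrite -(subrKA (f t)) -[nrm _](nrmN S) opprD !opprB.
    apply: le_trans (nrmD _ _ _) _; rewrite addrC.
    have := hc n t; have := hc n.+1 t; rewrite exprS /op_coord.
    rewrite -[nrm (f t - sval t.2 (c n (sval t.1)))](nrmN S) opprB.
    have := e_gt0 n; lra.
  have [||d cd] := @limit_linear R K S V B c.
  + exact: (banach_frechet S B).1.1.
  + move=> v; apply: (cvg_summable (S := S) (a := fun n => (1 / 2) ^+ n)).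
    * exact: (banach_frechet S B).1.2.
    * by move=> n; exact: ltW.
    * exact: half_expr_summable.
    * move=> N /csn_le_rnorm[D D0 ND]; exists (D * (2 * L v)); apply: nearW => n.
      apply: le_trans (ND _) _; rewrite -!mulrA ler_wpM2l//.
      by apply: le_trans (cS n v) _; rewrite -mulrA (mulrC (L v)).
  exists d; first by exists C.
  move=> t; apply/eqP; rewrite -subr_eq0; apply/eqP/(nrm_small (S := S)) => e e0.
  have e2 : 0 < e / 2 by lra.
  have [n [/= h1 h2]] := @filter_ex _ \oo _ _
    (filterI (cvg_near (cd (sval t.1)) (csn_rnorm S B) e2) (half_expr_small e2)).
  have h3 := svalP t.2 (c n (sval t.1) - d (sval t.1)); rewrite linearB in h3.
  have := nrmD S (f t - op_coord (c n) t) (op_coord (c n) t - op_coord d t).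
  rewrite subrKA; have := hc n t; rewrite /op_coord in h3 *; lra.
Defined.

End OperatorSpace.

(** A bilinear map I * V -> B is a map from I to a Banach space of operators from
    V to B, so [extend_to_function_space] applies. *)
Theorem extend_bilinear (I E Q V : tvsType K) (i : {linear I -> E})
    (p : {linear E -> Q}) (B : completeNormedModType K) (b : {bilinear I -> V -> B}) :
  frechet_extension i p -> nuclear_space Q -> continuous_bilinear b ->
  exists2 b' : {bilinear E -> V -> B},
    continuous_bilinear b' & forall x v, b' (i x) v = b x v.
Proof.
move=> hip nQ cb.
have [M [L [hM hL bML]]] := continuous_bilinear_csn cb (csn_rnorm S B).
pose G := operators B hL.1.
have ul t : linear (fun x => op_coord (L := L) (b x) t).
  by move=> a x y; rewrite /op_coord linearPl linearP.
have ub x t : nrm (op_coord (L := L) (b x) t) <= M x.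
  apply: le_trans (svalP t.2 _) _; apply: le_trans (bML _ _) _.
  by rewrite ler_piMr ?(semi_ge0 hM.1)//; exact: (svalP t.1).
have um x : fs_mem G (op_coord (L := L) (b x)).
  by exists (b x); [exists (M x); exact: ub|].
have cu : continuous (bfun_lin ul um) by apply: (continuous_to_bfun hM); exact: ub.
have [l cl li] := extend_to_function_space hip nQ cu.
have /choice[c hc] x : exists c : {linear V -> B},
    forall t, l x t = op_coord (L := L) c t.
  by have [c _ xc] := bfun_mem (l x); exists c.
have vanish (d : {linear V -> B}) :
    (forall t : op_index L B, op_coord d t = 0) -> forall v, d v = 0.
  move=> d0 v; apply: (rnorm_eq0 (S := S)); apply/eqP.
  rewrite eq_le (semi_ge0 (rnorm_seminorm S B)) andbT -(mul0r (L v)).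
  apply: (semi_dominated_scale (semi_comp (rnorm_seminorm S B) d) hL.1 (lexx 0)).
  by move=> w Lw; apply: (op_bound (L := L)) Lw => t; rewrite d0 nrm0.
have cl1 v : linear (fun x => c x v).
  move=> a x y; apply/eqP; rewrite -subr_eq0; apply/eqP.
  pose d : {linear V -> B} := c (a *: x + y) \- (a \*: c x \+ c y).
  rewrite -[LHS]/(d v); apply: vanish => t.
  have := hc (a *: x + y) t; rewrite linearP bfunD bfunZ !hc /op_coord /=.
  by rewrite linearB /= linearP /= => ->; rewrite subrr.
exists (mkbilin cl1 (fun x => linearP (c x))).
  apply: (csn_continuous_bilinear (S := S)) => N /csn_le_rnorm[D D0 ND].
  exists (fun x => D * supn (l x)), L; split => //.
    by apply: csnZ => //; exact: csn_comp cl (supn_csn _).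
  move=> x v; apply: le_trans (ND _) _; rewrite -mulrA ler_wpM2l//.
  apply: (semi_dominated_scale (semi_comp (rnorm_seminorm S B) (c x)) hL.1 (supn_ge0 _)).
  by move=> w Lw; apply: (op_bound (L := L)) Lw => t; rewrite -hc; exact: nrm_le_supn.
move=> x v; apply/eqP; rewrite -subr_eq0; apply/eqP.
pose d : {linear V -> B} := c (i x) \- b x.
rewrite -[LHS]/(d v); apply: vanish => t.
by rewrite /op_coord /= linearB -[sval t.2 (c _ _)]hc li subrr.
Qed.

Lemma tensor_ext (E F T W : tvsType K) (t : {bilinear E -> F -> T})
    (g h : {linear T -> W}) :
  complete_projective_tensor t -> complete_hausdorff W ->
  continuous g -> continuous h -> (forall x y, g (t x y) = h (t x y)) -> g =1 h.
Proof.
move=> [_ ct ut] hW cg ch gh.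
have bl y : linear (fun x => g (t x y)) by move=> a x x'; rewrite linearPl linearP.
have br x : linear (fun y => g (t x y)) by move=> a y y'; rewrite !linearP.
have cb : continuous_bilinear (mkbilin bl br).
  move=> z; apply: (continuous_comp (f := fun xy => t xy.1 xy.2) (g := g)).
    exact: ct.
  exact: cg.
have [k [_ _ ku]] := ut W (mkbilin bl br) hW cb.
by move=> z; rewrite (ku g cg)// (ku h ch)// => x y; rewrite /= gh.
Qed.

End ExtensionOfMaps.

(** * Projective seminorms on tensor products *)

Section TensorSeminorms.
Variables (R : realType) (K : numFieldType) (S : scalars R K).
Local Notation rho := (rho S).
Local Notation nrm := (nrm S).
Local Notation csn := (@csn R K S _).

Lemma bilinear_continuous_l (E F T : tvsType K) (t : {bilinear E -> F -> T}) v :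
  continuous_bilinear t -> continuous (fun x => t x v).
Proof.
move=> ct; have tl : linear (fun x => t x v) by exact: linearPl.
apply: (@continuous_csn R K S E T (mklin tl)) => N hN.
have [M [L [hM hL NML]]] := continuous_bilinear_csn ct hN.
exists (fun x => L v * M x); first by apply: csnZ hM; exact: semi_ge0 hL.1 _.
by move=> x; rewrite mulrC; exact: NML.
Qed.

(** pi is the projective tensor product of s and q, characterized as the largest
    continuous seminorm that satisfies the estimate on elementary tensors. *)
Definition projective_bound (E F T : tvsType K) (t : {bilinear E -> F -> T})
    (s : E -> R) (q : F -> R) (pi : T -> R) : Prop :=
  [/\ csn pi, forall x y, pi (t x y) <= s x * q y &
      forall N, csn N -> (forall x y, N (t x y) <= s x * q y) ->
        forall z, N z <= pi z].

(** Evaluation at all bilinear forms bounded by s * q is a bilinear map into some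
    l^oo, so it factors through T; pi is the norm of the factorization. For
    maximality, a functional phi on T with |phi| <= N and phi z = N z restricts
    to one of these bilinear forms. *)
Lemma projective_seminorm (E F T : tvsType K) (t : {bilinear E -> F -> T}) s q :
  complete_projective_tensor t -> csn s -> csn q ->
  exists pi, projective_bound t s q pi.
Proof.
move=> ut hs hq; have [hT ct uT] := ut.
pose A := {beta : {bilinear E -> F -> K^o} | forall x y, nrm (beta x y) <= s x * q y}.
have bm x y : fs_mem (linfty S A) (fun beta : A => sval beta x y).
  by exists (s x * q y) => beta; exact: (svalP beta).
have bl y : linear (fun x => mkbfun (bm x y)).
  by move=> a x x'; apply: bfun_ext => beta; rewrite bfunD bfunZ; exact: (linearPl (sval beta)).
have br x : linear (fun y => mkbfun (bm x y)).
  by move=> a y y'; apply: bfun_ext => beta; rewrite bfunD bfunZ; exact: (linearPr (sval beta)).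
have bound x y : supn (mkbfun (bm x y)) <= s x * q y.
  apply: supn_le => [|beta]; last exact: (svalP beta).
  by rewrite mulr_ge0 ?(semi_ge0 hs.1) ?(semi_ge0 hq.1).
have cb : continuous_bilinear (mkbilin bl br).
  apply: (csn_continuous_bilinear (S := S)) => N /csn_le_rnorm[D D0 ND].
  exists (fun x => D * s x), q; split => //; first exact: csnZ.
  move=> x y; apply: le_trans (ND _) _; rewrite rnorm_bfun -mulrA ler_wpM2l//.
  exact: bound.
have [g [cg gb _]] := uT _ (mkbilin bl br) (banach_frechet S (bfun (linfty S A))).1 cb.
exists (fun z => supn (g z)); split.
- exact: csn_comp cg (supn_csn _).
- by move=> x y; rewrite gb; exact: bound.
- move=> N hN Nt z; have [phi phiN phiz] := hahn_banach_point z hN.1.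
  have phil y : linear (fun x => phi (t x y)) by move=> a x x'; rewrite linearPl linearP.
  have phir x : linear (fun y => phi (t x y)) by move=> a y y'; rewrite !linearP.
  have betaP x y : nrm (mkbilin phil phir x y) <= s x * q y.
    exact: le_trans (phiN _) (Nt x y).
  pose beta : A := exist _ (mkbilin phil phir) betaP.
  have evl : linear (fun w => g w beta : K^o).
    by move=> a w w'; rewrite linearP bfunD bfunZ.
  have evE : mklin evl =1 phi.
    apply: (tensor_ext ut (scalar_frechet S).1).
    + apply: (continuous_functional (csn_comp cg (supn_csn _))) => w /=.
      exact: nrm_le_supn.
    + exact: continuous_functional hN phiN.
    + by move=> x y /=; rewrite gb.
  have := nrm_le_supn (g z) beta; rewrite -[g z beta]/(mklin evl z) evE phiz nrm_rho//.
  exact: semi_ge0 hN.1 _.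
Qed.

Lemma projective_basis (E F T : tvsType K) (t : {bilinear E -> F -> T}) s q :
  complete_projective_tensor t -> seminorm_basis S s -> seminorm_basis S q ->
  exists pi : nat -> T -> R, (forall n, projective_bound t (s n) (q n) (pi n)) /\
    forall N, csn N -> exists n0, forall n z, (n0 <= n)%N -> N z <= pi n z.
Proof.
move=> ut [hs smono sb] [hq qmono qb].
have /choice[pi hpi] n : exists pi, projective_bound t (s n) (q n) pi.
  exact: projective_seminorm.
exists pi; split => // N hN; have [_ ct _] := ut.
have [M [L [hM hL NML]]] := continuous_bilinear_csn ct hN.
have [a Ma] := sb M hM; have [b Lb] := qb L hL.
exists (maxn a b) => n z; rewrite geq_max => /andP[an bn].
have [_ _] := hpi n; apply => // x y; apply: le_trans (NML x y) _.
apply: ler_pM; rewrite ?(semi_ge0 hM.1) ?(semi_ge0 hL.1)//.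
  exact: le_trans (Ma x) (smono _ _ x an).
exact: le_trans (Lb y) (qmono _ _ y bn).
Qed.

Lemma projective_frechet (E F T : tvsType K) (t : {bilinear E -> F -> T}) :
  complete_projective_tensor t -> frechet_space E -> frechet_space F ->
  frechet_space T.
Proof.
move=> ut [_ /(countable_seminorm_basis S)[s bs]] [_ /(countable_seminorm_basis S)[q bq]].
have [hT _ _] := ut; split => //.
have [pi [hpi pib]] := projective_basis ut bs bq.
apply: (seminorm_basis_countable (S := S) (s := pi)); first by move=> n; case: (hpi n).
by move=> N /pib[n0 h]; exists n0 => z; exact: h.
Qed.

End TensorSeminorms.

(** * Exactness of the tensored diagram *)

Section TensoredExtension.
Variables (R : realType) (K : numFieldType) (S : scalars R K).
Local Notation rho := (rho S).
Local Notation nrm := (nrm S).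
Local Notation csn := (@csn R K S _).

Variables (I E Q V : tvsType K) (i : {linear I -> E}) (p : {linear E -> Q}).
Hypotheses (hip : frechet_extension i p) (nQ : nuclear_space Q).
Hypothesis fV : frechet_space V.
Variables (IV EV QV : tvsType K).
Variables (tI : {bilinear I -> V -> IV}) (tE : {bilinear E -> V -> EV}).
Variable tQ : {bilinear Q -> V -> QV}.
Variables (iV : {linear IV -> EV}) (pV : {linear EV -> QV}).
Hypotheses (uI : complete_projective_tensor tI) (uE : complete_projective_tensor tE).
Hypotheses (uQ : complete_projective_tensor tQ).
Hypotheses (tiV : tensor_id tI tE i iV) (tpV : tensor_id tE tQ p pV).

Let fI : frechet_space I. Proof. by have [[]] := hip. Qed.
Let fE : frechet_space E. Proof. by have [[]] := hip. Qed.
Let fQ : frechet_space Q. Proof. by have [[]] := hip. Qed.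
Let cp : continuous p. Proof. by have [_ []] := hip. Qed.
Let cok : frechet_cokernel i p. Proof. by have [_ []] := hip. Qed.

Lemma tensored_extend (B : completeNormedModType K) (u : {linear IV -> B}) :
  continuous u -> exists2 l : {linear EV -> B}, continuous l & forall z, l (iV z) = u z.
Proof.
move=> cu; have [_ cI _] := uI.
have bl v : linear (fun x => u (tI x v)) by move=> a x x'; rewrite linearPl linearP.
have br x : linear (fun v => u (tI x v)) by move=> a v v'; rewrite !linearP.
have cb : continuous_bilinear (mkbilin bl br).
  move=> z; apply: (continuous_comp (f := fun xy => tI xy.1 xy.2) (g := u)).
    exact: cI.
  exact: cu.
have [b' cb' b'i] := extend_bilinear S hip nQ cb.
have [_ _ uE3] := uE; have [l [cl lb _]] := uE3 B b' (banach_frechet S B).1 cb'.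
exists l => //.
have lil : linear (fun z => l (iV z)) by move=> a x y; rewrite !linearP.
suff : mklin lil =1 u by [].
apply: (tensor_ext uI (banach_frechet S B).1) => //.
  by move=> x; apply: continuous_comp; [exact: tiV.1|exact: cl].
by move=> x v /=; rewrite tiV.2 lb b'i.
Qed.

(** Apply [tensored_extend] to the map I (x) V -> l^oo whose norm is N. *)
Lemma tensored_embedding (N : IV -> R) : csn N ->
  exists2 M, csn M & forall z, N z <= M (iV z).
Proof.
move=> hN; pose A := {phi : {linear IV -> K^o} | forall z, nrm (phi z) <= N z}.
have ul (phi : A) : linear (fun z => sval phi z) by exact: linearP.
have um z : fs_mem (linfty S A) (fun phi => sval phi z).
  by exists (N z) => phi; exact: (svalP phi).
have cu : continuous (bfun_lin ul um).
  by apply: (continuous_to_bfun hN) => z phi; exact: (svalP phi).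
have [l cl li] := tensored_extend cu.
exists (fun y => supn (l y)); first exact: csn_comp cl (supn_csn _).
move=> z; rewrite li; have [phi phiN phiz] := hahn_banach_point z hN.1.
have := nrm_le_supn (bfun_lin ul um z) (exist _ phi phiN : A).
by rewrite /= phiz nrm_rho// (semi_ge0 hN.1).
Qed.

Lemma tensored_comp0 z : pV (iV z) = 0.
Proof.
have lin1 : linear (fun z => pV (iV z)) by move=> a x y; rewrite !linearP.
have lin0 : linear (fun _ : IV => 0 : QV) by move=> a x y; rewrite scaler0 addr0.
have [hQV _ _] := uQ.
suff : mklin lin1 =1 mklin lin0 by apply.
apply: (tensor_ext uI hQV).
- by move=> x; apply: continuous_comp; [exact: tiV.1|exact: tpV.1].
- by move=> x; exact: cvg_cst.
- by move=> x v /=; rewrite tiV.2 tpV.2 cok.1 linear0l.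
Qed.

(** A map f on E (x) V that vanishes on I (x) V is a bilinear map vanishing on
    I * V, and factors for each v in V through Q by the cokernel property of p.
    Joint continuity of the resulting bilinear map c on Q * V is the cokernel
    property for the map that sends x in E to the function
    (v, phi) |-> phi (f (x (x) v)). *)
Lemma tensored_cokernel : frechet_cokernel iV pV.
Proof.
split=> [|W f fW cf f0]; first exact: tensored_comp0.
have [_ cE _] := uE.
have fl v : linear (fun x => f (tE x v)) by move=> a x x'; rewrite linearPl linearP.
have cfl v : continuous (mklin (fl v)).
  move=> x; apply: (continuous_comp (f := fun x => tE x v) (g := f)).
    exact: (bilinear_continuous_l S).
  exact: cf.
have /choice[c hc] v : exists c : {linear Q -> W},
    continuous c /\ forall x, c (p x) = f (tE x v).
  have [|c [cc cp' _]] := cok.2 W (mklin (fl v)) fW (cfl v).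
    by move=> x /=; rewrite -tiV.2 f0.
  by exists c.
have cr y : linear (fun v => c v y).
  move=> a v v'; pose d : {linear Q -> W} := a \*: c v \+ c v'.
  rewrite -[RHS]/(d y).
  apply: (cokernel_epi cok fW cp (hc _).1) => [|x] /=.
    apply: (continuous_csn (S := S)) => N hN.
    exists (fun y => nrm a * N (c v y) + N (c v' y)).
      apply: csnD; last exact: csn_comp (hc _).1 hN.
      by apply: csnZ (csn_comp (hc _).1 hN); exact: nrm_ge0.
    by move=> y' /=; apply: le_trans (hN.1.1 _ _) _; rewrite hN.1.2.
  by rewrite !(hc _).2 linearPr linearP.
have cl v : linear (fun y => c v y) by exact: linearP.
have cb : continuous_bilinear (mkbilin cl cr).
  apply: (csn_continuous_bilinear (S := S)) => N hN.
  have hNf := csn_comp cf hN.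
  have [M [L [hM hL NML]]] := continuous_bilinear_csn cE hNf.
  pose A : Type := ({v : V | L v <= 1} *
    {phi : {linear W -> K^o} | forall w, nrm (phi w) <= N w})%type.
  pose F x (t : A) : K^o := sval t.2 (f (tE x (sval t.1))).
  have FM x t : nrm (F x t) <= M x.
    apply: le_trans (svalP t.2 _) _; apply: le_trans (NML _ _) _.
    by rewrite ler_piMr ?(semi_ge0 hM.1)//; exact: (svalP t.1).
  have Fl t : linear (fun x => F x t).
    by move=> a x y; rewrite /F linearPl !linearP.
  have Fm x : fs_mem (linfty S A) (F x) by exists (M x); exact: FM.
  have cF : continuous (bfun_lin Fl Fm) by apply: (continuous_to_bfun hM); exact: FM.
  have [|G [cG Gp _]] := cok.2 _ (bfun_lin Fl Fm) (banach_frechet S _) cF.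
    move=> x; apply: bfun_ext => t; rewrite bfun0 -[LHS]/(F (i x) t) /F.
    by rewrite -tiV.2 f0 linear0.
  have Gc (t : A) y : G y t = sval t.2 (c (sval t.1) y).
    have l1 : linear (fun y => G y t : K^o).
      by move=> a x x'; rewrite linearP bfunD bfunZ.
    have l2 : linear (fun y => sval t.2 (c (sval t.1) y)).
      by move=> a x x'; rewrite !linearP.
    apply: (cokernel_epi (g := mklin l1) (h := mklin l2) cok (scalar_frechet S) cp).
    - apply: (continuous_functional (csn_comp cG (supn_csn _))) => x.
      exact: nrm_le_supn.
    - apply: (continuous_functional (csn_comp (hc (sval t.1)).1 hN)) => x.
      exact: (svalP t.2).
    - by move=> x /=; rewrite Gp (hc _).2.
  exists (fun y => supn (G y)), L; split => //; first exact: csn_comp cG (supn_csn _).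
  move=> y; apply: (semi_dominated_scale (semi_comp hN.1 (mklin (cr y))) hL.1 (supn_ge0 _)).
  move=> v Lv /=; have [phi phiN phiv] := hahn_banach_point (c v y) hN.1.
  have := nrm_le_supn (G y) (exist _ v Lv, exist _ phi phiN).
  by rewrite Gc /= phiv nrm_rho// (semi_ge0 hN.1).
have [_ _ uQ3] := uQ; have [g [cg gb _]] := uQ3 W (mkbilin cl cr) fW.1 cb.
have gp y : g (pV y) = f y.
  have l1 : linear (fun y => g (pV y)) by move=> a x x'; rewrite !linearP.
  suff : mklin l1 =1 f by apply.
  apply: (tensor_ext uE fW.1) => //.
    by move=> x; apply: continuous_comp; [exact: tpV.1|exact: cg].
  by move=> x v /=; rewrite tpV.2 gb /= (hc v).2.
exists g; split => // h ch hp.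
apply: (tensor_ext (g := h) (h := g) uQ fW.1) => // y v; have [_ cQ _] := uQ.
have lg (k : {linear QV -> W}) : linear (fun y => k (tQ y v)).
  by move=> a x x'; rewrite linearPl linearP.
have ck (k : {linear QV -> W}) : continuous k -> continuous (mklin (lg k)).
  move=> ck x; apply: (continuous_comp (f := fun x => tQ x v) (g := k)).
    exact: (bilinear_continuous_l S).
  exact: ck.
apply: (cokernel_epi (g := mklin (lg h)) (h := mklin (lg g)) cok fW cp (ck _ ch) (ck _ cg)).
by move=> x /=; rewrite -tpV.2 hp gp.
Qed.

(** By Hahn-Banach and the cokernel property, a vector y of ker pV is in the
    closure of the range of iV: a functional vanishing on this range factors
    through pV. Approximate preimages of y then form a Cauchy sequence by
    [tensored_embedding]. *)
Lemma tensored_range y : pV y = 0 -> exists z, iV z = y.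
Proof.
move=> py; have fEV := projective_frechet S uE fE fV.
have [s [hs smono sb]] := countable_seminorm_basis S fEV.2.
have Gsub : linear_subspace [set iV z | z in setT].
  split; first by exists 0; rewrite ?linear0.
  by move=> a _ _ [z _ <-] [z' _ <-]; exists (a *: z + z'); rewrite ?linearP.
have approx N e : csn N -> 0 < e -> exists z, N (y - iV z) < e.
  move=> hN e0.
  have [d hd [dN dG dadh]] := quotient_seminorm hN.1 Gsub.
  have [phi phid phiy] := hahn_banach_point y hd.
  have cphi : continuous phi.
    by apply: (continuous_functional hN) => x; exact: le_trans (phid x) (dN x).
  have [|psi [_ psip _]] := tensored_cokernel.2 _ phi (scalar_frechet S) cphi.
    move=> z; apply: (nrm_le0 (S := S)).
    by have := phid (iV z); rewrite dG//; exists z.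
  have dy : d y = 0.
    apply: (fmorph_inj rho); rewrite -phiy -psip py linear0.
    by rewrite rmorph0.
  by have [_ [z _ <-] h] := dadh y e e0; exists z; rewrite dy add0r in h.
have e_gt0 n := half_expr_gt0 R n.
have /choice[z hz] n : exists z, s n (y - iV z) < (1 / 2) ^+ n.
  exact: approx (hs n) (e_gt0 n).
(* The sequence z is Cauchy because iV \o z converges to y. *)
have [[_ cIV] _ _] := uI.
have [z0 zz0] : exists z0 : IV, z @ \oo --> z0.
  apply: (cvg_summable (S := S) (a := fun n => (1 / 2) ^+ n)).
  - exact: cIV.
  - by move=> n; exact: ltW.
  - exact: half_expr_summable.
  - move=> N /tensored_embedding[M hM NM]; have [k Mk] := sb M hM.
    exists 2; near=> n.
    have kn : (k <= n)%N by near: n; exists k.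
    apply: le_trans (NM _) _; apply: le_trans (Mk _) _; rewrite linearB.
    have h1 := le_lt_trans (smono _ _ (y - iV (z n)) kn) (hz n).
    have h2 := le_lt_trans (smono _ _ (y - iV (z n.+1)) (leqW kn)) (hz n.+1).
    have := semi_tri (hs k).1 y (iV (z n.+1)) (iV (z n)).
    rewrite (semiC (hs k).1 (iV (z n.+1)) y); have := e_gt0 n; rewrite exprS in h2; lra.
exists z0; have hEV := fEV.1.1.
apply: (hausdorff_csn_eq (S := S)) => // N e hN e0.
have [k Nk] := sb N hN; have e2 : 0 < e / 2 by lra.
have kn : \forall n \near \oo, (k <= n)%N by exists k.
have [n [/= h1 [h2 h3]]] := @filter_ex _ \oo _ _
  (filterI (cvg_near zz0 (csn_comp tiV.1 hN) e2) (filterI (half_expr_small e2) kn)).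
rewrite /= linearB in h1.
have h4 := le_lt_trans (smono _ _ (y - iV (z n)) h3) (hz n).
have h5 := Nk (y - iV (z n)).
have := semi_tri hN.1 (iV (z n)) (iV z0) y.
rewrite (semiC hN.1 (iV z0) (iV (z n))) (semiC hN.1 (iV (z n)) y); lra.
Unshelve. all: by end_near. Qed.

Lemma tensored_kernel : frechet_kernel iV pV.
Proof.
split=> [|W f fW cf pf]; first exact: tensored_comp0.
have [[hIV _] _ _] := uI.
have inj : injective iV.
  move=> z z' zz'; apply/eqP; rewrite -subr_eq0; apply/eqP.
  apply: ((hausdorff_csnP S IV).1 hIV) => N /[dup] hN /tensored_embedding[M hM NM].
  apply/eqP; rewrite eq_le (semi_ge0 hN.1) andbT; apply: le_trans (NM _) _.
  by rewrite linearB zz' subrr (semi0 hM.1).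
have /choice[g gf] w : exists z, iV z = f w by exact: tensored_range.
have gl : linear g by move=> a x y; apply: inj; rewrite linearP !gf linearP.
exists (mklin gl); split => //.
  apply: (continuous_csn (S := S)) => N /tensored_embedding[M hM NM].
  exists (fun w => M (f w)); first exact: csn_comp cf hM.
  by move=> w; apply: le_trans (NM _) _; rewrite /= gf.
by move=> h ch hf w; apply: inj; rewrite hf /= gf.
Qed.

Lemma tensored_extension : frechet_extension iV pV.
Proof.
split; first by split; [exact: (projective_frechet S uI)|
  exact: (projective_frechet S uE)|exact: (projective_frechet S uQ)].
by split; [exact: tiV.1|exact: tpV.1|exact: tensored_kernel|exact: tensored_cokernel].
Qed.

End TensoredExtension.

(** * Approximate sections of an extension with nuclear quotient *)

Section ApproximateSections.
Variables (R : realType) (K : numFieldType) (S : scalars R K).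
Local Notation rho := (rho S).
Local Notation nrm := (nrm S).
Local Notation csn := (@csn R K S _).

Lemma nuclear_tail (Q : lmodType K) (B : completeNormedModType K) (u : Q -> B)
    (mu : nat -> R) (f : nat -> {linear Q -> K^o}) (y : nat -> B) (M : Q -> R) C x n :
  (forall n, 0 <= mu n) -> cvgn (series mu) -> 0 <= C -> 0 <= M x ->
  (forall n, nrm (f n x) <= mu n * M x) -> (forall n, rnorm S (y n) <= C) ->
  series (fun n => f n x *: y n) @ \oo --> u x ->
  rnorm S (u x - series (fun n => f n x *: y n) n) <=
    C * M x * (limn (series mu) - series mu n).
Proof.
move=> mu0 cmu C0 M0 fM yC fyu; have hN := rnorm_seminorm S B.
have muS k := series_le_limn k mu0 cmu.
apply: (limit_le fyu (csn_rnorm S B)); exists n => // m /= /subnKC <-.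
apply: (@le_trans _ _ (C * M x * (series mu (n + (m - n))%N - series mu n))); last first.
  by rewrite ler_wpM2l ?mulr_ge0// lerD2r.
elim: (m - n)%N => [|k IH]; first by rewrite addn0 !subrr (semi0 hN) mulr0.
rewrite addnS; apply: le_trans (semi_tri hN (series (fun n => f n x *: y n) (n + k)%N) _ _) _.
rewrite seriesSB hN.2.
have h : nrm (f (n + k)%N x) * rnorm S (y (n + k)%N) <= mu (n + k)%N * M x * C.
  by apply: ler_pM => //; [exact: nrm_ge0|exact: semi_ge0 hN _].
have := seriesSB mu (n + k)%N; nra.
Qed.

(** Truncate the nuclear series of sigma, and replace its finitely many vectors
    by nearby values of iota. The seminorm M comes from the functionals of the
    series, and is therefore independent of the precision e. *)
Lemma approximate_lift (Q X : tvsType K) (T : Type)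
    (iota : {linear X -> bfun (linfty S T)})
    (sigma : {linear Q -> bfun (closure_range iota)}) :
  nuclear_space Q -> continuous sigma ->
  exists2 M, csn M & forall e, 0 < e -> exists2 A : {linear Q -> X}, continuous A &
    forall y t, nrm (sigma y t - iota (A y) t) <= e * M y.
Proof.
move=> [_ nQ] cs.
have [mu [f [z [M [C [[mu0 mucv] hM fM [C0 zC] fzs]]]]]] := nuclear_series S (nQ _ sigma cs).
have M0 y : 0 <= M y by exact: semi_ge0 hM.1 y.
exists M => // e e0.
have A0 := limn_series_ge0 mu0 mucv.
have d0 : 0 < e / 2 / (C + 1) by rewrite !divr_gt0//; lra.
have d1 : 0 < e / 2 / (limn (series mu) + 1) by rewrite !divr_gt0//; lra.
have [n _ /(_ n (leqnn n))/= tail] := (cvgrPdist_lt (F := \oo) (series mu) _).1 mucv _ d0.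
have /choice[x hx] k : exists x, forall t,
    nrm (z k t - iota x t) <= e / 2 / (limn (series mu) + 1).
  by have [x hx] := bfun_mem (z k) _ d1; exists x.
have Al : linear (fun y => \sum_(0 <= k < n) f k y *: x k).
  move=> a y y'; rewrite scaler_sumr -big_split /=.
  by apply: eq_bigr => j _; rewrite linearP scalerDl scalerA.
exists (mklin Al).
  apply: (continuous_csn (S := S)) => N hN.
  exists (fun y => (\sum_(0 <= k < n) mu k * N (x k)) * M y).
    apply: csnZ hM; apply: sumr_ge0 => k _.
    by apply: mulr_ge0 => //; exact: semi_ge0 hN.1 _.
  move=> y /=; apply: le_trans (semi_sum hN.1 _ _) _; rewrite mulr_suml.
  apply: ler_sum => k _; rewrite hN.1.2 mulrAC ler_wpM2r//.
  exact: semi_ge0 hN.1 _.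
move=> y t.
have st1 : nrm (sigma y t - \sum_(0 <= k < n) f k y * z k t) <= e / 2 * M y.
  have := nuclear_tail n mu0 mucv C0 (M0 y) (fun n => fM n y) zC (fzs y).
  rewrite rnorm_bfun => h; have := nrm_le_supn (sigma y - series (fun n => f n y *: z n) n) t.
  rewrite bfunB.
  have -> : series (fun n => f n y *: z n) n t = \sum_(0 <= k < n) f k y * z k t.
    by rewrite /series bfun_sum; apply: eq_bigr => k _; rewrite bfunZ.
  move=> h'; apply: le_trans h' (le_trans h _).
  rewrite (mulrAC C) ler_wpM2r//.
  have C1 : 0 < C + 1 by lra.
  rewrite (ltr_pdivlMr _ _ C1) in tail; move: tail; set r := limn _ - _ => tail; have := ler_norm r.
  by have := normr_ge0 r; nra.
have st2 : nrm (\sum_(0 <= k < n) f k y * z k t - iota (mklin Al y) t) <= e / 2 * M y.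
  rewrite /= linear_sum bfun_sum -sumrB.
  apply: le_trans (semi_sum (nrm_seminorm S) _ _) _.
  apply: (@le_trans _ _ (\sum_(0 <= k < n) mu k * (M y * (e / 2 / (limn (series mu) + 1))))).
    apply: ler_sum => k _; rewrite linearZ_LR bfunZ -mulrBr nrmM mulrA.
    by apply: ler_pM => //; exact: nrm_ge0.
  rewrite -mulr_suml.
  have sl := series_le_limn n mu0 mucv.
  rewrite mulrCA (mulrC _ (M y)) ler_wpM2l// mulrA ler_pdivrMr; last lra.
  by rewrite /series/= in sl; nra.
rewrite -(subrKA (\sum_(0 <= k < n) f k y * z k t)).
by apply: le_trans (nrmD _ _ _) _; lra.
Qed.

End ApproximateSections.

Lemma dependent_choice (J : Type) (T : J -> Type) (P : forall j, T j -> Prop) :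
  (forall j, exists x, P j x) -> exists f, forall j, P j (f j).
Proof. by move=> h; exists (fun j => sval (cid (h j))) => j; exact: svalP. Qed.

Section ApproximateSectionsOfExtension.
Variables (R : realType) (K : numFieldType) (S : scalars R K).
Local Notation rho := (rho S).
Local Notation nrm := (nrm S).
Local Notation csn := (@csn R K S _).
Variables (I E Q : tvsType K) (i : {linear I -> E}) (p : {linear E -> Q}).
Hypotheses (hip : frechet_extension i p) (nQ : nuclear_space Q).

Lemma nrm_telescope (a b c r t : K) :
  nrm (a - b - c) <= nrm (r - b) + (nrm (t - r - c) + nrm (t - a)).
Proof.
have -> : a - b - c = (r - b) + ((t - r - c) - (t - a)) by ring.
apply: le_trans (nrmD _ _ _) _; rewrite lerD2l.
by apply: le_trans (nrmD _ _ _) _; rewrite nrmN.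
Qed.

Let ci : continuous i. Proof. by have [_ []] := hip. Qed.
Let cp : continuous p. Proof. by have [_ []] := hip. Qed.
Let cok : frechet_cokernel i p. Proof. by have [_ []] := hip. Qed.

Definition polar (s : E -> R) : Type :=
  {phi : {linear E -> K^o} | forall x, nrm (phi x) <= s x}.

Section OneSeminorm.
Variables (s : E -> R) (hs : csn s).

Lemma polar_lin (phi : polar s) : linear (fun x => sval phi x).
Proof. exact: linearP. Qed.

Lemma polar_mem x : fs_mem (linfty S (polar s)) (fun phi => sval phi x).
Proof. by exists (s x) => phi; exact: (svalP phi). Qed.

(** By [polar_sup] the norm of the value at x is s x, so that the closure of the
    range is the completion of E for the seminorm s. *)
Definition polar_eval : {linear E -> bfun (linfty S (polar s))} :=
  bfun_lin polar_lin polar_mem.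

Lemma polar_kernel_lin (phi : polar s) : linear (fun z => sval phi (i z)).
Proof. by move=> a x y; rewrite !linearP. Qed.

Definition polar_kernel_eval : {linear I -> bfun (linfty S (polar s))} :=
  bfun_lin polar_kernel_lin (fun z => polar_mem (i z)).

Lemma polar_sup x C : (forall phi : polar s, nrm (sval phi x) <= C) -> s x <= C.
Proof.
have [phi phis phix] := hahn_banach_point x hs.1.
by move=> /(_ (exist _ phi phis)); rewrite /= phix nrm_rho ?(semi_ge0 hs.1).
Qed.

(** The map l extends to E the inclusion of I into its completion for s. Hence
    the inclusion of E into its own completion minus l vanishes on I, and
    induces a map sigma on Q that splits p modulo the closure of I. *)
Lemma local_section :
  exists l : {linear E -> bfun (closure_range polar_kernel_eval)},
  exists sigma : {linear Q -> bfun (closure_range polar_eval)},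
  [/\ continuous l, continuous sigma,
      forall z phi, l (i z) phi = sval phi (i z) &
      forall x phi, sigma (p x) phi = sval phi x - l x phi].
Proof.
have um z : fs_mem (closure_range polar_kernel_eval) (fun phi => sval phi (i z)).
  by move=> e e0; exists z => phi; rewrite subrr nrm0 ltW.
have cu : continuous (bfun_lin polar_kernel_lin um).
  apply: (continuous_to_bfun (csn_comp ci hs)) => z phi.
  exact: (svalP phi).
have [l cl li] := extend_to_function_space hip nQ cu.
have liE z phi : l (i z) phi = sval phi (i z) by rewrite li.
have rl (phi : polar s) : linear (fun x => sval phi x - l x phi : K^o).
  move=> a x y; rewrite (linearP l) bfunD bfunZ (linearP (sval phi)) /GRing.scale/=.
  by rewrite opprD addrACA -mulrBr.
have rm x : fs_mem (closure_range polar_eval) (fun phi => sval phi x - l x phi).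
  move=> e e0; have [z hz] := bfun_mem (l x) _ e0.
  exists (x - i z) => phi.
  have hphi : nrm (l x phi - sval phi (i z)) <= e := hz phi.
  suff : nrm (sval phi x - l x phi - sval phi (x - i z)) <= e by [].
  by rewrite linearB opprB addrC subrKA -(nrmN S) opprB.
have cr : continuous (bfun_lin rl rm).
  apply: (continuous_to_bfun (csnD hs (csn_comp cl (supn_csn _)))) => x phi.
  apply: le_trans (nrmD _ _ _) _; rewrite nrmN; apply: lerD.
    exact: (svalP phi).
  exact: nrm_le_supn.
have [|sigma [cs sp _]] := cok.2 _ _ (banach_frechet S _) cr.
  by move=> z; apply: bfun_ext => phi; rewrite bfun0 -[LHS]/(sval phi (i z) - l (i z) phi) liE subrr.
by exists l, sigma; split => // x phi; rewrite sp.
Qed.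

End OneSeminorm.

Lemma functional_epi (g h : Q -> K^o) N :
  linear g -> linear h -> csn N -> (forall y, nrm (g y) <= N y) ->
  (forall y, nrm (h y) <= N y) -> (forall x, g (p x) = h (p x)) -> g =1 h.
Proof.
move=> gl hl hN gN hhN gh.
apply: (cokernel_epi (g := mklin gl) (h := mklin hl) cok (scalar_frechet S) cp) => //.
  exact: (@continuous_functional R K S Q (mklin gl) N hN gN).
exact: (@continuous_functional R K S Q (mklin hl) N hN hhN).
Qed.

(** A Mittag-Leffler argument. In the notation of the proof, sg n is the local
    section at level n, and tau n the difference of two consecutive local
    sections, which takes values in the completion of I at level n. Approximate
    sg n by A n : Q -> E and tau n by C n : Q -> I. Then A n minus the sum of
    the C k for k < n still splits p approximately, because the corrections
    take values in I, and its increments are small. It is essential that M is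
    chosen before eps. *)
Lemma approximate_sections (s : nat -> E -> R) : seminorm_basis S s ->
  exists2 M : nat -> Q -> R, forall n, csn (M n) &
  forall eps : nat -> R, (forall n, 0 < eps n) ->
  exists A : nat -> {linear Q -> E},
  [/\ forall n, continuous (A n),
      forall n y, s n (A n.+1 y - A n y) <= eps n * M n y &
      forall r n, csn r -> (forall x, r (p x) <= s n x) ->
        forall y, r (p (A n y) - y) <= eps n * M n y].
Proof.
move=> [hs smono sb].
have [l hl] := dependent_choice (fun n => local_section (hs n)).
have [sg hsg] := dependent_choice hl.
have cl n : continuous (l n) by case: (hsg n).
have cs n : continuous (sg n) by case: (hsg n).
have li n z phi : l n (i z) phi = sval phi (i z) by case: (hsg n).
have sp n x phi : sg n (p x) phi = sval phi x - l n x phi by case: (hsg n).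
(* Restriction along j is the canonical map from the completion at level n.+1 to
   the one at level n. *)
pose j n (phi : polar (s n)) : polar (s n.+1) :=
  exist (fun psi : {linear E -> K^o} => forall x, nrm (psi x) <= s n.+1 x)
    (sval phi) (fun x => le_trans (svalP phi x) (smono n n.+1 x (leqnSn n))).
pose GI n := closure_range (polar_kernel_eval (s n)).
have tl n (phi : polar (s n)) : linear (fun x => l n x phi - l n.+1 x (j n phi) : K^o).
  move=> a x y; rewrite (linearP (l n)) (linearP (l n.+1)) !bfunD !bfunZ /GRing.scale/=; ring.
have tm n x : fs_mem (GI n) (fun phi => l n x phi - l n.+1 x (j n phi)).
  move=> e e0; have e2 : 0 < e / 2 by lra.
  have [z hz] := bfun_mem (l n x) _ e2; have [z' hz'] := bfun_mem (l n.+1 x) _ e2.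
  exists (z - z') => phi.
  have h1 : nrm (l n x phi - sval phi (i z)) <= e / 2 := hz phi.
  have h2 : nrm (l n.+1 x (j n phi) - sval phi (i z')) <= e / 2 := hz' (j n phi).
  suff : nrm (l n x phi - l n.+1 x (j n phi) - sval phi (i (z - z'))) <= e by [].
  have -> : l n x phi - l n.+1 x (j n phi) - sval phi (i (z - z')) =
      (l n x phi - sval phi (i z)) - (l n.+1 x (j n phi) - sval phi (i z')).
    by rewrite (linearB i) (linearB (sval phi)) !opprD !opprK addrACA.
  by apply: le_trans (nrmD _ _ _) _; rewrite nrmN; lra.
have ct n : continuous (bfun_lin (tl n) (tm n)).
  apply: (continuous_to_bfun (csnD (csn_comp (cl n) (supn_csn _))
    (csn_comp (cl n.+1) (supn_csn _)))) => x phi.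
  by apply: le_trans (nrmD _ _ _) _; rewrite nrmN; apply: lerD; exact: nrm_le_supn.
have etau n : exists tau : {linear Q -> bfun (GI n)}, continuous tau /\
    forall x phi, tau (p x) phi = l n x phi - l n.+1 x (j n phi).
  have [|tau [ctau tp _]] := cok.2 _ _ (banach_frechet S _) (ct n).
    move=> z; apply: bfun_ext => phi; rewrite bfun0.
    by rewrite -[LHS]/(l n (i z) phi - l n.+1 (i z) (j n phi)) !li subrr.
  by exists tau; split=> // x phi; rewrite tp.
have [tau htau] := dependent_choice etau.
have tauE n y phi : tau n y phi = sg n.+1 y (j n phi) - sg n y phi.
  have h1 : linear (fun y => tau n y phi : K^o).
    by move=> a x x'; rewrite linearP bfunD bfunZ.
  have h2 : linear (fun y => sg n.+1 y (j n phi) - sg n y phi : K^o).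
    by move=> a x x'; rewrite (linearP (sg n.+1)) (linearP (sg n)) !bfunD !bfunZ /GRing.scale/=; ring.
  apply: (functional_epi (N := fun y => supn (tau n y)
    + (supn (sg n.+1 y) + supn (sg n y))) h1 h2).
  - apply: csnD; first exact: csn_comp (htau n).1 (supn_csn _).
    by apply: csnD; [exact: csn_comp (cs n.+1) (supn_csn _)
                    |exact: csn_comp (cs n) (supn_csn _)].
  - move=> x; have := nrm_le_supn (tau n x) phi.
    by have := supn_ge0 (sg n.+1 x); have := supn_ge0 (sg n x); lra.
  - move=> x; apply: le_trans (nrmD _ _ _) _; rewrite nrmN.
    have := nrm_le_supn (sg n.+1 x) (j n phi); have := nrm_le_supn (sg n x) phi.
    by have := supn_ge0 (tau n x); lra.
  - by move=> x; rewrite (htau n).2 !sp /=; ring.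
have /choice[M1 apx1] n : exists M, csn M /\ forall e, 0 < e ->
    exists2 A : {linear Q -> E}, continuous A &
    forall y (phi : polar (s n)), nrm (sg n y phi - sval phi (A y)) <= e * M y.
  by have [M hM hA] := approximate_lift nQ (cs n); exists M.
have /choice[M2 apx2] n : exists M, csn M /\ forall e, 0 < e ->
    exists2 A : {linear Q -> I}, continuous A &
    forall y (phi : polar (s n)), nrm (tau n y phi - sval phi (i (A y))) <= e * M y.
  by have [M hM hA] := approximate_lift nQ (htau n).1; exists M.
have M10 n y : 0 <= M1 n y by exact: semi_ge0 (apx1 n).1.1 y.
have M20 n y : 0 <= M2 n y by exact: semi_ge0 (apx2 n).1.1 y.
exists (fun n y => M1 n y + (M1 n.+1 y + M2 n y)).
  by move=> n; apply: csnD (apx1 n).1 (csnD (apx1 n.+1).1 (apx2 n).1).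
move=> eps eps0.
(* The increment at n involves the approximations at n and n.+1, hence the
   precision at n is bounded both by eps n and by eps n.-1. *)
pose d n := Order.min (eps n) (eps n.-1).
have d0 n : 0 < d n by rewrite lt_min !eps0.
have /choice[A hA] n : exists A : {linear Q -> E}, continuous A /\
    forall y (phi : polar (s n)), nrm (sg n y phi - sval phi (A y)) <= d n * M1 n y.
  by have [A cA AP] := (apx1 n).2 _ (d0 n); exists A.
have /choice[C hC] n : exists C : {linear Q -> I}, continuous C /\
    forall y (phi : polar (s n)), nrm (tau n y phi - sval phi (i (C y))) <= eps n * M2 n y.
  by have [C cC CP] := (apx2 n).2 _ (eps0 n); exists C.
have Bl n : linear (fun y => A n y - \sum_(0 <= k < n) i (C k y)).
  move=> a y y'; rewrite linearP scalerBr addrACA -opprD; congr (_ - _).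
  by rewrite scaler_sumr -big_split /=; apply: eq_bigr => k _; rewrite !linearP.
exists (fun n => mklin (Bl n)); split.
- move=> n; apply: (continuous_csn (S := S)) => N hN.
  exists (fun y => N (A n y) + \sum_(0 <= k < n) N (i (C k y))).
    apply: csnD; first exact: csn_comp (hA n).1 hN.
    elim: n => [|n IH].
      rewrite (_ : (fun _ => _) = fun y => 0 * N (A 0%N y)).
        exact: csnZ (lexx 0) (csn_comp (hA 0%N).1 hN).
      by apply/funext => y; rewrite big_geq// mul0r.
    rewrite (_ : (fun _ => _) = fun y => \sum_(0 <= k < n) N (i (C k y)) + N (i (C n y))).
      exact: csnD IH (csn_comp (hC n).1 (csn_comp ci hN)).
    by apply/funext => y; rewrite big_nat_recr.
  move=> y /=; apply: le_trans (semiB hN.1 _ _) _; rewrite lerD2l.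
  exact: (@semi_sum R K S _ N hN.1 _ _ (fun k => i (C k y))).
- move=> n y /=; apply: (polar_sup (hs n)) => phi.
  rewrite big_nat_recr//= (_ : _ - _ = A n.+1 y - A n y - i (C n y)); last first.
    rewrite opprB opprD (addrC (- \sum_(0 <= k < n) _)) addrA addrA subrK.
    by rewrite addrAC.
  have h1 := (hA n.+1).2 y (j n phi); have h2 := (hA n).2 y phi.
  have h3 := (hC n).2 y phi; rewrite tauE in h3.
  rewrite !linearB.
  have d1 : d n.+1 <= eps n by rewrite ge_min lexx orbT.
  have d2 : d n <= eps n by rewrite ge_min lexx.
  apply: le_trans (nrm_telescope _ _ _ (sg n y phi) (sg n.+1 y (j n phi))) _.
  have := M10 n y; have := M10 n.+1 y; move: h1 h2 h3; rewrite /j /=.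
  set t1 := nrm _; set t2 := nrm _; set t3 := nrm _; nra.
- move=> r n hr rp y.
  have [phi phir phiy] := hahn_banach_point (p (mklin (Bl n) y) - y) hr.1.
  have pphil : linear (fun x => phi (p x)) by move=> a x x'; rewrite !linearP.
  (* Composition with p sends the polar of r to functionals that vanish on I, on
     which sg n is therefore the identity. *)
  pose pphi : polar (s n) := exist (fun psi : {linear E -> K^o} =>
    forall x, nrm (psi x) <= s n x) (mklin pphil) (fun x => le_trans (phir _) (rp x)).
  have l0 x : l n x pphi = 0.
    apply: (nrm_small (S := S)) => e e0; have [z hz] := bfun_mem (l n x) _ e0.
    have : nrm (l n x pphi - phi (p (i z))) <= e := hz pphi.
    by rewrite cok.1 linear0 subr0.
  have sgE x : sg n x pphi = phi x.
    have h1 : linear (fun y => sg n y pphi : K^o).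
      by move=> a z z'; rewrite linearP bfunD bfunZ.
    apply: (functional_epi (N := fun y => supn (sg n y) + r y) h1 (linearP phi)).
    + by apply: csnD; [exact: csn_comp (cs n) (supn_csn _)|].
    + move=> z; have := nrm_le_supn (sg n z) pphi.
      by have := semi_ge0 hr.1 z; lra.
    + by move=> z; have := phir z; have := supn_ge0 (sg n z); lra.
    + by move=> z; rewrite sp l0 subr0.
  have pB : p (mklin (Bl n) y) = p (A n y).
    rewrite /= linearB linear_sum big1 ?subr0// => k _.
    exact: cok.1.
  have d2 : d n <= eps n by rewrite ge_min lexx.
  have : r (p (mklin (Bl n) y) - y) = nrm (phi (p (A n y) - y)).
    by rewrite -pB phiy nrm_rho// (semi_ge0 hr.1).
  move=> ->; rewrite linearB -[phi y]sgE -(nrmN S) opprB.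
  have h2 : nrm (sg n y pphi - phi (p (A n y))) <= d n * M1 n y := (hA n).2 y pphi.
  apply: le_trans h2 _; have := M10 n y; have := M10 n.+1 y; have := M20 n y.
  have := eps0 n; nra.
Qed.

End ApproximateSectionsOfExtension.

(** * Lifting compact maps *)

Section Lifting.
Variables (R : realType) (K : numFieldType) (S : scalars R K).
Local Notation rho := (rho S).
Local Notation nrm := (nrm S).
Local Notation csn := (@csn R K S _).

Lemma csn_continuous (E : tvsType K) (N : E -> R) : csn N -> continuous N.
Proof.
move=> hN x; apply/cvgrPdist_lt => e e0.
apply: filterS (csn_nbhs x hN e0) => y /= yx; apply: le_lt_trans yx.
rewrite ler_norml; have := semi_leB hN.1 x y; have := semi_leB hN.1 y x.
by rewrite (semiC hN.1 x y) => h1 h2; apply/andP; split; lra.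
Qed.

(** A continuous seminorm is bounded on a compact set. *)
Lemma compact_linear_map_continuous (V : completeNormedModType K) (Q : tvsType K)
    (u : {linear V -> Q}) : compact_linear_map u -> continuous u.
Proof.
rewrite /compact_linear_map precompactE => cu.
apply: (continuous_csn (S := S)) => N hN.
have := compact_bounded (continuous_compact (continuous_subspaceT (csn_continuous hN)) cu).
move=> [C [_ hC]]; pose D := Num.max C 0 + 1.
have D0 : 0 <= D by rewrite /D addr_ge0// le_max lexx orbT.
have CD : C < D by rewrite /D ltr_pwDr// le_max lexx.
exists (fun v => D * rnorm S v); first exact: csnZ (csn_rnorm S V).
have hn := rnorm_seminorm S V.
have Dp : 0 < D by rewrite /D ltr_wpDl// le_max lexx orbT.
have Di : 0 <= D^-1 by rewrite invr_ge0.
move=> v; rewrite -ler_pdivrMl//.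
apply: (semi_dominated (semi_scale (semi_comp hN.1 u) Di) hn) => w w1.
rewrite ler_pdivrMl// mulr1; apply: le_trans (ler_norm _) _.
apply: (hC D CD); exists (u w) => //; apply: subset_closure; exists w => //.
by rewrite -ball_normE /= sub0r normrN -(rho_rnorm S) -(rmorph1 rho) rho_lt.
Qed.

Variables (I E Q V : tvsType K) (i : {linear I -> E}) (p : {linear E -> Q}).
Hypotheses (hip : frechet_extension i p) (nQ : nuclear_space Q).
Hypothesis fV : frechet_space V.
Variables (EV QV : tvsType K).
Variables (tE : {bilinear E -> V -> EV}) (tQ : {bilinear Q -> V -> QV}).
Variable (pV : {linear EV -> QV}).
Hypotheses (uE : complete_projective_tensor tE) (uQ : complete_projective_tensor tQ).
Hypothesis tpV : tensor_id tE tQ p pV.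

Lemma tensor_map (A : {linear Q -> E}) : continuous A ->
  exists2 AV : {linear QV -> EV}, continuous AV & forall y v, AV (tQ y v) = tE (A y) v.
Proof.
move=> cA; have [hEV cE _] := uE; have [_ _ uQ3] := uQ.
have bl v : linear (fun y => tE (A y) v) by move=> a x y; rewrite linearP linearPl.
have br y : linear (fun v => tE (A y) v) by exact: linearPr.
have cb : continuous_bilinear (mkbilin bl br).
  apply: (csn_continuous_bilinear (S := S)) => N hN.
  have [M [L [hM hL NML]]] := continuous_bilinear_csn cE hN.
  by exists (M \o A), L; split=> [||x y]; [exact: csn_comp|by []|exact: NML].
by have [AV [cAV AVb _]] := uQ3 EV (mkbilin bl br) hEV cb; exists AV.
Qed.

(** With T n = A n (x) id, the estimates of [approximate_sections] pass to the
    projective seminorms by maximality. The norms C n of u are finite, so eps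
    can be chosen such that the increments of T n \o u are summable on the unit
    ball. *)
Lemma tensored_lift (B : completeNormedModType K) (u : {linear B -> QV}) :
  continuous u ->
  exists2 w : {linear B -> EV}, continuous w & forall b, pV (w b) = u b.
Proof.
move=> cu; have [[_ fE fQ] [_ cp _ _]] := hip.
have [s bs] := countable_seminorm_basis S fE.2.
have [q bq] := countable_seminorm_basis S fV.2.
have [M hM secM] := approximate_sections hip nQ bs.
have [piE [hpiE piEb]] := projective_basis uE bs bq.
have [hs smono sb] := bs; have [hq qmono qb] := bq.
have /choice[piQ hpiQ] n : exists pi, projective_bound S tQ (M n) (q n) pi.
  exact: projective_seminorm.
have /choice[C hC] n : exists C, 0 <= C /\ forall b, piQ n (u b) <= C * rnorm S b.
  have [hpi _ _] := hpiQ n; have [C C0 CM] := csn_le_rnorm (csn_comp cu hpi).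
  by exists C.
have g0 n := half_expr_gt0 R n.
pose eps n : R := (1 / 2) ^+ n / (C n + 1).
have C1 n : 0 < C n + 1 by have := (hC n).1; lra.
have eps0 n : 0 < eps n by rewrite divr_gt0.
have epsC n b : eps n * piQ n (u b) <= (1 / 2) ^+ n * rnorm S b.
  rewrite /eps mulrAC ler_pdivrMr// -mulrA ler_wpM2l ?(ltW (g0 n))//.
  apply: le_trans ((hC n).2 b) _; rewrite mulrC.
  by rewrite ler_wpM2l ?(semi_ge0 (rnorm_seminorm S B))//; lra.
have [A [cA Astep Aapp]] := secM eps eps0.
have /choice[T hT] n : exists T : {linear QV -> EV}, continuous T /\
    forall y v, T (tQ y v) = tE (A n y) v.
  by have [T cT TA] := tensor_map (cA n); exists T.
have dominated n (N : QV -> R) : csn N ->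
    (forall y v, N (tQ y v) <= eps n * M n y * q n v) ->
    forall b, N (u b) <= (1 / 2) ^+ n * rnorm S b.
  move=> hN Nb b; apply: le_trans (epsC n b).
  have ei : 0 <= (eps n)^-1 by rewrite invr_ge0 ltW.
  have [_ _ dom] := hpiQ n; rewrite -ler_pdivrMl//.
  apply: (dom (fun z => (eps n)^-1 * N z)); first exact: csnZ.
  by move=> y v; rewrite ler_pdivrMl// mulrA.
have step n b : piE n (T n.+1 (u b) - T n (u b)) <= (1 / 2) ^+ n * rnorm S b.
  pose D : {linear QV -> EV} := T n.+1 \- T n.
  have [hpi pit _] := hpiE n.
  apply: (dominated n (fun z => piE n (D z))) => [|y v].
    apply: (csn_le (C := 1) (csnD (csn_comp (hT n.+1).1 hpi) (csn_comp (hT n).1 hpi))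
      (semi_comp hpi.1 D)) => z.
    by rewrite mul1r; exact: semiB hpi.1 _ _.
  rewrite /= !(hT _).2 -linearBl; apply: le_trans (pit _ _) _.
  by rewrite ler_wpM2r ?(semi_ge0 (hq n).1).
have app N : csn N -> exists n0, forall n b, (n0 <= n)%N ->
    N (pV (T n (u b)) - u b) <= (1 / 2) ^+ n * rnorm S b.
  move=> hN; have [_ cQ _] := uQ.
  have [r [L [hr hL NrL]]] := continuous_bilinear_csn cQ hN.
  have [n1 rs] := sb _ (csn_comp cp hr); have [n2 Lq] := qb L hL.
  exists (maxn n1 n2) => n b; rewrite geq_max => /andP[n1n n2n].
  have Dl : linear (fun z => pV (T n z) - z).
    by move=> a x y; rewrite (linearP (T n)) (linearP pV) scalerBr opprD addrACA.
  apply: (dominated n (fun z => N (mklin Dl z))) => [|y v].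
    apply: (csn_le (C := 1) (csnD (csn_comp (hT n).1 (csn_comp tpV.1 hN)) hN)
      (semi_comp hN.1 (mklin Dl))) => z.
    by rewrite mul1r; exact: semiB hN.1 _ _.
  rewrite /= (hT n).2 tpV.2 -linearBl; apply: le_trans (NrL _ _) _.
  apply: ler_pM; [exact: semi_ge0 hr.1 _|exact: semi_ge0 hL.1 _| |].
    apply: Aapp => // x; apply: le_trans (rs x) _; exact: smono.
  by apply: le_trans (Lq v) (qmono _ _ _ n2n).
have ul n : linear (fun b => T n (u b)) by move=> a x y; rewrite !linearP.
have [[[hEV cEV] cE _] [[hQV _] _ _]] := (uE, uQ).
have [||w wlim] := @limit_linear R K S B EV (fun n => mklin (ul n)).
- exact: hEV.
- move=> b; apply: (cvg_summable (S := S) (a := fun n => (1 / 2) ^+ n)).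
  + exact: cEV.
  + by move=> n; exact: ltW.
  + exact: half_expr_summable.
  + move=> N /piEb[n0 Npi]; exists (rnorm S b); exists n0 => // n /= n0n.
    by apply: le_trans (Npi n _ n0n) _; rewrite mulrC; exact: step.
exists w.
  apply: (continuous_csn (S := S)) => N hN; have [n0 Npi] := piEb N hN.
  pose G : R := limn (series (fun n => (1 / 2 : R) ^+ n)).
  have sG n : series (fun n => (1 / 2 : R) ^+ n) n <= G.
    by apply: series_le_limn => [k|]; [exact: ltW|exact: half_expr_summable].
  have G0 : 0 <= G.
    by apply: limn_series_ge0 => [k|]; [exact: ltW|exact: half_expr_summable].
  exists (fun b => G * rnorm S b + N (T n0 (u b))).
    apply: csnD; first exact: csnZ (csn_rnorm S B).
    exact: csn_comp cu (csn_comp (hT n0).1 hN).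
  have bound b k : N (T (n0 + k)%N (u b) - T n0 (u b)) <= G * rnorm S b.
    have b0 : 0 <= rnorm S b by exact: semi_ge0 (rnorm_seminorm S B) b.
    apply: (@le_trans _ _ ((series (fun n => (1 / 2 : R) ^+ n) (n0 + k)%N) * rnorm S b)).
      elim: k => [|k IH].
        rewrite addn0 subrr (semi0 hN.1); apply: mulr_ge0 => //.
        by apply: sumr_ge0 => j _; exact: ltW.
      rewrite addnS; apply: le_trans (semi_tri hN.1 (T (n0 + k)%N (u b)) _ _) _.
      have h1 := le_trans (Npi _ (T (n0 + k).+1 (u b) - T (n0 + k)%N (u b)) (leq_addr k n0)) (step _ _).
      by have := seriesSB (fun n => (1 / 2 : R) ^+ n) (n0 + k)%N; nra.
    by rewrite ler_wpM2r.
  move=> b; apply: le_trans (semi_leB hN.1 _ (T n0 (u b))) _; rewrite lerD2r.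
  apply: (limit_le (wlim b) hN); exists n0 => // n /= n0n.
  by rewrite -(subnKC n0n); exact: bound.
move=> b; apply: (hausdorff_csn_eq (S := S)) => // N e hN e0.
have [n0 happ] := app N hN.
have b1 : 0 < rnorm S b + 1.
  by have := semi_ge0 (rnorm_seminorm S B) b; lra.
have e2 : 0 < e / 2 by lra.
have e3 : 0 < e / 2 / (rnorm S b + 1) by rewrite divr_gt0.
have nn : \forall n \near \oo, (n0 <= n)%N by exists n0.
have [n [/= h1 [h2 h3]]] := @filter_ex _ \oo _ _
  (filterI (cvg_near (wlim b) (csn_comp tpV.1 hN) e2) (filterI (half_expr_small e3) nn)).
rewrite ltr_pdivlMr// in h2; have h4 := happ n b h3.
rewrite /= linearB in h1.
have := semi_tri hN.1 (pV (T n (u b))) (pV (w b)) (u b).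
rewrite (semiC hN.1 (pV (w b)) (pV (T n (u b)))).
by have := g0 n; have := semi_ge0 (rnorm_seminorm S B) b; nra.
Qed.

End Lifting.

Lemma pure_split (R : realType) (K : numFieldType) (S : scalars R K)
    (I E Q : tvsType K) (i : {linear I -> E}) (p : {linear E -> Q}) :
  frechet_extension i p -> nuclear_space Q ->
  pure_ind_locally_split i p /\ pure_pro_locally_split i p.
Proof.
move=> hip nQ; split=> V fV IV EV QV tI tE tQ iV pV uI uE uQ tiV tpV;
  (split; first exact: (tensored_extension S hip nQ fV uI uE uQ tiV tpV)).
  move=> B u /(compact_linear_map_continuous S) cu.
  exact: (tensored_lift S hip nQ fV uE uQ tpV).
move=> B u cu.
exact: (tensored_extend S hip nQ uI uE tiV).
Qed.

Theorem theorem2p21 (R : realType) (K : numFieldType)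
    (hK : K = (R : numFieldType) \/ K = (R[i]%C : numFieldType))
    (I E Q : tvsType K)
    (i : {linear I -> E}) (p : {linear E -> Q})
    (hip : frechet_extension i p) (hQ : nuclear_space Q) :
  pure_ind_locally_split i p /\ pure_pro_locally_split i p.
Proof.
case: hK => hK; subst K.
  exact: (pure_split (real_scalars R) hip hQ).
exact: (pure_split (complex_scalars R) hip hQ).
Qed.
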